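(* Let $\mathsf X\in\{\mathsf A,\mathsf C\}$, let $n\ge1$, let $\mathsf n=n$ if $\mathsf X=\mathsf A$ and $\mathsf n=2n$ if $\mathsf X=\mathsf C$, let $\ell\in\{0,1,\dots,\mathsf n\}$, and let $P$ be a lattice polytope in $\mathbb{R}^{\mathsf n}$ with $\mathscr{E}_{\mathsf n,\ell}(P)\neq0$. Then for all coprime $a,b\in\mathbb{N}$, $$C^{\mathsf X}_{P,\ell}(ab)=C^{\mathsf X}_{P,\ell}(a)\,C^{\mathsf X}_{P,\ell}(b).$$
   Context: A lattice polytope in $\mathbb{R}^{\mathsf n}$ is the convex hull of finitely many points of $\mathbb{Z}^{\mathsf n}$. For a lattice $\Lambda$ with $\mathbb{Z}^{\mathsf n}\subseteq\Lambda\subset\mathbb{Q}^{\mathsf n}$ and a lattice polytope $P$, $E^\Lambda_P$ is the polynomial with $E^\Lambda_P(m)=\#(mP\cap\Lambda)$ for $m\in\mathbb{N}$, $\mathscr{E}^\Lambda_{\mathsf n,\ell}(P)$ is its coefficient of $Y^\ell$, and $\mathscr{E}_{\mathsf n,\ell}=\mathscr{E}^{\mathbb{Z}^{\mathsf n}}_{\mathsf n,\ell}$. Type $\mathsf A$: $C^{\mathsf A}_{P,\ell}(m)=\frac{1}{\mathscr{E}_{n,\ell}(P)}\sum_\Lambda\mathscr{E}^\Lambda_{n,\ell}(P)$, the sum over all lattices $\Lambda$ with $\mathbb{Z}^n\subseteq\Lambda\subset\mathbb{Q}^n$ and $|\Lambda:\mathbb{Z}^n|=m$. Type $\mathsf C$: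 let $J=\begin{pmatrix}0&I_n\\-I_n&0\end{pmatrix}$ and $\mathrm{GSp}_{2n}(\mathbb{Q})=\{A\in\mathrm{GL}_{2n}(\mathbb{Q}):A^{\mathsf t}JA=\kappa J,\ \kappa\in\mathbb{Q}^\times\}$. A symplectic superlattice of $\mathbb{Z}^{2n}$ of index $m$ is a lattice of the form $\Lambda=\mathbb{Z}$-span of the rows of $(g^{-1})^{\mathsf t}$ for some $g\in\mathrm{GSp}_{2n}(\mathbb{Q})\cap\mathrm{Mat}_{2n}(\mathbb{Z})$ with $|\det g|=m$. Then $C^{\mathsf C}_{P,\ell}(m)=\frac{1}{\mathscr{E}_{2n,\ell}(P)}\sum_\Lambda\mathscr{E}^\Lambda_{2n,\ell}(P)$, the sum over all symplectic superlattices $\Lambda$ of index $m$. *)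

(* Defs.v *)
From HB Require Import structures.
From mathcomp Require Import all_boot all_order all_algebra.
From mathcomp Require Import boolp classical_sets functions cardinality fsbigop.
From mathcomp Require Import reals convex.

Set Implicit Arguments.
Unset Strict Implicit.
Unset Printing Implicit Defensive.

Import Order.TTheory GRing.Theory Num.Theory.

Local Open Scope classical_set_scope.
Local Open Scope card_scope.
Local Open Scope ring_scope.

Definition convex_hull (R : realType) (k : nat) (A : set 'rV[R]_k) :
    set 'rV[R]_k :=
  smallest (@convex_set R 'rV[R]_k) A.

Definition lattice_polytope (R : realType) (k : nat) (P : set 'rV[R]_k) : Prop :=
  exists2 V : set 'rV[int]_k,
    finite_set V & P = convex_hull [set map_mx intr v | v in V].

(* The set of integral linear combinations of the rows of B. *)
Definition row_span (k : nat) (B : 'M[rat]_k) : set 'rV[rat]_k :=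
  range (fun z : 'rV[int]_k => map_mx intr z *m B).
Arguments row_span {k} B.

Definition is_lattice (k : nat) (L : set 'rV[rat]_k) : Prop :=
  exists2 B : 'M[rat]_k, B \in unitmx & L = row_span B.

(* Z^k, as a subset of Q^k. *)
Definition Zlattice (k : nat) : set 'rV[rat]_k :=
  range (fun z : 'rV[int]_k => map_mx intr z).
Arguments Zlattice k : clear implicits.

(* |L : Z^k| = m: the set of cosets x + Z^k with x in L has m elements. *)
Definition has_index (k : nat) (L : set 'rV[rat]_k) (m : nat) : Prop :=
  [set [set x + z | z in Zlattice k] | x in L] #= `I_m.

(* The points of mP /\ L, where L is embedded in R^k by ratr. *)
Definition dilate_points (R : realType) (k : nat) (P : set 'rV[R]_k)
    (L : set 'rV[rat]_k) (m : nat) : set 'rV[rat]_k :=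
  L `&` [set x | [set m%:R *: p | p in P] (map_mx ratr x)].

(* The natural numbers m are the positive ones, here and for indices. *)
Definition is_ehrhart (R : realType) (k : nat) (P : set 'rV[R]_k)
    (L : set 'rV[rat]_k) (E : {poly rat}) : Prop :=
  forall m : nat, (0 < m)%N ->
    exists2 c : nat, dilate_points P L m #= `I_c & E.[m%:R] = c%:R.

(* At most one polynomial satisfies is_ehrhart P L, and by Ehrhart's theorem
   one does when P is a lattice polytope and L a lattice containing Z^k; the
   default value 0 is irrelevant in that case. *)
Definition ehrhart_poly (R : realType) (k : nat) (P : set 'rV[R]_k)
    (L : set 'rV[rat]_k) : {poly rat} :=
  xget 0 [set E | is_ehrhart P L E].

Definition ehrhart_coef (R : realType) (k : nat) (P : set 'rV[R]_k)
    (L : set 'rV[rat]_k) (l : nat) : rat :=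
  (ehrhart_poly P L)`_l.

Definition superlattices (k m : nat) : set (set 'rV[rat]_k) :=
  [set L | [/\ is_lattice L, Zlattice k `<=` L & has_index L m]].
Arguments superlattices k m : clear implicits.

Definition Jmx (n : nat) : 'M[rat]_(n + n) :=
  block_mx 0 1%:M (- 1%:M) 0.

Definition GSp (n : nat) : set 'M[rat]_(n + n) :=
  [set A | A \in unitmx /\
     exists2 kappa : rat, kappa != 0 & A^T *m Jmx n *m A = kappa *: Jmx n].
Arguments GSp n : clear implicits.

Definition symplectic_superlattices (n m : nat) : set (set 'rV[rat]_(n + n)) :=
  [set L | exists g : 'M[int]_(n + n),
     [/\ GSp n (map_mx intr g), `|\det g| = m%:Z &
         L = row_span (invmx (map_mx intr g))^T]].
Arguments symplectic_superlattices n m : clear implicits.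

Inductive lie_type := TypeA | TypeC.

Definition ambient_dim (X : lie_type) (n : nat) : nat :=
  match X with TypeA => n | TypeC => (n + n)%N end.

Definition superlattices_of_type (X : lie_type) (n m : nat) :
    set (set 'rV[rat]_(ambient_dim X n)) :=
  match X with
  | TypeA => superlattices n m
  | TypeC => symplectic_superlattices n m
  end.
Arguments superlattices_of_type X n m : clear implicits.

(* \sum_(L \in _) is a sum over the finite support of the summand; only
   finitely many superlattices have a given index, so it is the full sum. *)
Definition hecke_coef (R : realType) (X : lie_type) (n : nat)
    (P : set 'rV[R]_(ambient_dim X n)) (l m : nat) : rat :=
  (ehrhart_coef P (Zlattice (ambient_dim X n)) l)^-1 *
  \sum_(L \in superlattices_of_type X n m) ehrhart_coef P L l.
Arguments hecke_coef {R} X n P l m.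

(* Main.v *)
From mathcomp Require Import all_boot all_order all_algebra all_fingroup all_solvable.
From mathcomp Require Import boolp classical_sets functions cardinality fsbigop.
From mathcomp Require Import reals convex interval_inference finmap unstable.
From mathcomp Require Import ring lra zify.
Require Import Defs.

Set Implicit Arguments.
Unset Strict Implicit.
Unset Printing Implicit Defensive.

Import Order.TTheory GRing.Theory Num.Theory.

Local Open Scope ring_scope.

(** Ehrhart's theorem gives every [E^L_P] as a polynomial: homogenize P to the
    cone over its vertices and represent each cone point by its lexicographically
    maximal nonnegative combination of the vertices.  Whether a combination is
    lexicographically maximal depends only on its support, the vertices in such a
    support are linearly independent, and the representation is unique.  So the
    cone is a disjoint union of relatively open simplicial cones, whose lattice
    points at height m are counted, for all m > 0, by sums of binomial polynomials.

    Next, the number of superlattices L of index m containing a point x depends only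
    on the order of x modulo Z^k, because GL_k(Z), respectively Sp_2n(Z), moves every
    integral vector to a multiple of the first basis vector.  By Moebius inversion
    it is the sum of the [w_d] over the d dividing m with [d x] in Z^k.  Summing over the
    points x of tP, and using #(tP /\ (1/d) Z^k) = E_P(dt), one finds
    [C_(P,l) m = \sum_d w_d d^l].  A superlattice L of index ab with a, b coprime is
    the sum of its a- and b-torsion parts modulo Z^k, which have index a and b, so the
    weights, hence the values of C, multiply. *)

(** * Lexicographically maximal representations *)

Section Lexicographic.
Variables (R : realFieldType) (N : nat).
Implicit Types (u c : 'rV[R]_N).

(** Types A and C share one argument, stated for a family [S m] of superlattices with three
    properties: members lie in (1/m) Z^k, unimodular matrices preserving every [S m] carry any
    integral vector to a multiple of one basis vector, and membership splits along coprime torsion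
    parts. The obstacle is the last property in type C, because the similitude that defines L does
    not visibly yield similitudes for the torsion parts of L. The matrix is therefore eliminated: L
    is symplectic exactly when its dual for J is kappa L, with index kappa^n. This condition passes
    to parts and sums by Bezout; the way back to a matrix is a symplectic basis for the form kappa
    J, which is integral and unimodular on L. In type A the index is read as the order of a finite
    abelian group, where Cauchy's theorem does the splitting. The weights w_d are kept as lists of
    pairs (weight, divisor): only the counting identity matters, so no uniqueness enters, and the
    list for ab is the product of the lists for a and b. *)

Definition lexpos u :=
  [exists i, (0 < u 0 i) && [forall j : 'I_N, (j < i)%N ==> (u 0 j == 0)]].

Definition supp u := [set i | u 0 i != 0].

Lemma lexposP u :
  reflect (exists2 i, 0 < u 0 i & forall j : 'I_N, (j < i)%N -> u 0 j = 0)
          (lexpos u).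
Proof.
apply: (iffP existsP) => -[i].
  by case/andP=> ui /forallP uj; exists i => // j ji; apply/eqP/(implyP (uj j)).
by move=> ui uj; exists i; rewrite ui; apply/forallP=> j; apply/implyP=> /uj/eqP.
Qed.

Lemma lexpos0 : lexpos 0 = false.
Proof. by apply/lexposP => -[i]; rewrite mxE ltxx. Qed.

Lemma lexposD u c : lexpos u -> lexpos c -> lexpos (u + c).
Proof.
move=> /lexposP[i ui uj] /lexposP[j cj cjs]; apply/lexposP.
case: (ltngtP i j) => [ij|ji|/val_inj eij].
- exists i => [|l li]; first by rewrite mxE cjs // addr0.
  by rewrite mxE uj // cjs ?addr0 // (ltn_trans li).
- exists j => [|l lj]; first by rewrite mxE uj // add0r.
  by rewrite mxE uj ?cjs ?addr0 // (ltn_trans lj).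
- subst j; exists i => [|l li]; first by rewrite mxE addr_gt0.
  by rewrite mxE uj ?cjs ?addr0.
Qed.

Lemma lexposZ t u : 0 < t -> lexpos u -> lexpos (t *: u).
Proof.
move=> t0 /lexposP[i ui uj]; apply/lexposP; exists i => [|j ji].
  by rewrite mxE mulr_gt0.
by rewrite mxE uj ?mulr0.
Qed.

Lemma lexpos_total u : u != 0 -> lexpos u || lexpos (- u).
Proof.
move=> /rV0Pn[i0 ui0].
have [i ui imin] := @arg_minnP _ i0 (fun i => u 0 i != 0) (fun i : 'I_N => i : nat) ui0.
have uj (j : 'I_N) : (j < i)%N -> u 0 j = 0.
  by move=> ji; apply/eqP/negPn/negP => /imin; rewrite leqNgt ji.
case: (ltgtP (u 0 i) 0) ui => // ui _; apply/orP; [right|left].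
  by apply/lexposP; exists i => [|j /uj]; rewrite !mxE ?oppr_gt0 // => ->; rewrite oppr0.
by apply/lexposP; exists i.
Qed.

(** Ratio test of the simplex method: the least ratio [c 0 i / - u 0 i] over the negative [u 0 i] is
    the longest step along [u] that keeps all coordinates nonnegative, and there the minimizing
    coordinate vanishes. *)
Lemma step_to_face c u :
  (forall i, 0 <= c 0 i) -> (exists i, u 0 i < 0) ->
  (forall i, c 0 i = 0 -> u 0 i = 0) ->
  exists2 t, 0 < t & (forall i, 0 <= (c + t *: u) 0 i) /\
    (exists2 i, c 0 i != 0 & (c + t *: u) 0 i = 0).
Proof.
move=> c0 [i0 ui0] cu.
have cpos i : u 0 i < 0 -> 0 < c 0 i.
  move=> ui; rewrite lt_def c0 andbT; apply/eqP => /cu ui_0.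
  by rewrite ui_0 ltxx in ui.
have [i ui imin] := @Order.TotalTheory.arg_minP _ _ _ i0 (fun i => u 0 i < 0)
  (fun i => c 0 i / - u 0 i) ui0.
exists (c 0 i / - u 0 i); first by rewrite divr_gt0 ?oppr_gt0 ?cpos.
split=> [j|]; last first.
  exists i; first by rewrite gt_eqF ?cpos.
  rewrite !mxE invrN mulrN mulNr divfK ?subrr //.
  by rewrite lt_eqF.
rewrite !mxE; have [uj|uj] := ltP (u 0 j) 0; last first.
  rewrite addr_ge0 // mulr_ge0 // divr_ge0 // oppr_ge0.
  exact: ltW.
have := imin j uj; rewrite ler_pdivlMr ?oppr_gt0 // mulrN.
by move=> h; rewrite -[X in _ + X]opprK subr_ge0.
Qed.

Lemma small_step c u :
  (forall i, 0 <= c 0 i) -> (forall i, c 0 i = 0 -> 0 <= u 0 i) ->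
  exists2 t, 0 < t & forall i, 0 <= (c + t *: u) 0 i.
Proof.
(* Coordinates with [c 0 i = 0] add nothing to [s], since division by zero gives 0; for the others
   [s] bounds the ratio of [u 0 i] to [c 0 i] in absolute value. *)
move=> c0 cu; pose s : R := 1 + \sum_i `|u 0 i| / c 0 i.
have q0 i : 0 <= `|u 0 i| / c 0 i by rewrite divr_ge0.
have s0 : 0 < s by rewrite ltr_wpDr // sumr_ge0.
exists s^-1 => [|i]; first by rewrite invr_gt0.
rewrite !mxE; have [ci|ci] := eqVneq (c 0 i) 0.
  by rewrite ci add0r mulr_ge0 ?cu // invr_ge0 ltW.
have cpos : 0 < c 0 i by rewrite lt_def ci c0.
suff: s^-1 * `|u 0 i| <= c 0 i.
  have := ler_norm (- u 0 i); rewrite normrN => h1 h2.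
  have : s^-1 * - u 0 i <= s^-1 * `|u 0 i| by rewrite ler_pM2l ?invr_gt0.
  rewrite mulrN; lra.
rewrite mulrC ler_pdivrMr // mulrC -ler_pdivrMr // /s (bigD1 i) //= addrCA.
by rewrite lerDl addr_ge0 ?sumr_ge0.
Qed.

End Lexicographic.

Section ConeRepresentation.
Variables (R : realFieldType) (N K : nat) (A : 'M[R]_(N, K)) (h : 'cV[R]_K).
Hypothesis Ah : A *m h = const_mx 1.
Implicit Types (u c : 'rV[R]_N) (S : {set 'I_N}).

Definition indep S := forall u, u *m A = 0 -> supp u \subset S -> u = 0.

(** The relations [u] that are nonnegative off [S] are the directions in which a nonnegative
    combination with support [S] can move while representing the same point; none of them may be a
    lexicographic increase. *)
Definition lexmax S := forall u, u *m A = 0 ->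
  (forall i, i \notin S -> 0 <= u 0 i) -> ~~ lexpos u.

Lemma height u : u *m A *m h = (\sum_i u 0 i)%:M.
Proof.
rewrite -mulmxA Ah; apply/matrixP => i j; rewrite !ord1 !mxE mulr1n.
by apply: eq_bigr => l _; rewrite mxE mulr1.
Qed.

(** All generators have height 1, so the coordinates of a relation add up to 0. Hence every move
    along a nonzero relation ends at a face. *)
Lemma ker_neg u : u *m A = 0 -> u != 0 -> exists i, u 0 i < 0.
Proof.
move=> uA u0; case: (boolP [exists i, u 0 i < 0]) => [/existsP //|].
rewrite negb_exists => /forallP u_ge0.
have {}u_ge0 i : 0 <= u 0 i by rewrite leNgt.
have /eqP := height u; rewrite uA mul0mx eq_sym -scalemx1 scaler_eq0.
rewrite oner_eq0 orbF psumr_eq0 // => /allP u_eq0.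
case/eqP: u0; apply/rowP => i; rewrite [RHS]mxE.
by apply/eqP/u_eq0; rewrite mem_index_enum.
Qed.

Lemma indep_inj c c' : c *m A = c' *m A -> supp c = supp c' ->
  indep (supp c) -> c = c'.
Proof.
move=> cA sc ic; apply/eqP; rewrite -subr_eq0; apply/eqP/ic.
  by rewrite mulmxBl cA subrr.
apply/fintype.subsetP => i; rewrite inE; apply: contraR => ci.
have ci' : i \notin supp c' by rewrite -sc.
move: ci ci'; rewrite !inE !negbK !mxE => /eqP -> /eqP ->.
by rewrite subrr.
Qed.

(** Caratheodory's reduction with a chosen orientation: a relation inside the support is taken
    lexicographically positive, so that moving along it until a coordinate vanishes both shrinks the
    support and increases the combination. *)
Lemma reduce_support c : (forall i, 0 <= c 0 i) -> exists c',
  [/\ (forall i, 0 <= c' 0 i), c' *m A = c *m A, indep (supp c') &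
      c' = c \/ lexpos (c' - c)].
Proof.
have [n] := ubnP #|supp c|; elim: n c => // n IHn c sn c0.
have [ic|] := pselect (indep (supp c)); first by exists c; split=> //; left.
move=> /existsNP[u0 /not_implyP[u0A /not_implyP[u0S /eqP u0_neq0]]].
have [u [uA uS u_pos]] : exists u, [/\ u *m A = 0, supp u \subset supp c & lexpos u].
  case/orP: (lexpos_total u0_neq0) => ?; first by exists u0.
  exists (- u0); split=> //; first by rewrite mulNmx u0A oppr0.
  by apply: fintype.subset_trans u0S; apply/fintype.subsetP=> i; rewrite !inE !mxE oppr_eq0.
have u_neq0 : u != 0 by apply: contraTneq u_pos => ->; rewrite lexpos0.
have cu i : c 0 i = 0 -> u 0 i = 0.
  move=> ci; apply/eqP; have := fintype.subsetP uS i; rewrite !inE ci eqxx /=.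
  by case: eqP => // _ /(_ isT).
have [t t0 [ct0 [i ci cti]]] := step_to_face c0 (ker_neg uA u_neq0) cu.
have lt_supp : (#|supp (c + t *: u)| < n)%N.
  rewrite -ltnS; apply: leq_trans sn; rewrite ltnS; apply: proper_card.
  apply/fintype.properP; split; last by exists i; rewrite !inE ?ci // cti eqxx.
  apply/fintype.subsetP=> j; rewrite !inE; apply: contra => /eqP cj.
  by rewrite !mxE cj cu // mulr0 addr0.
have [c' [c'0 c'A ic' lc']] := IHn _ lt_supp ct0.
exists c'; split=> //.
  by rewrite c'A mulmxDl -scalemxAl uA scaler0 addr0.
have lu := lexposZ t0 u_pos; right.
case: lc' => [->|lc']; first by rewrite addrAC subrr add0r.
by have := lexposD lc' lu; rewrite opprD addrA subrK.
Qed.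

Lemma lexmax_representation c : (forall i, 0 <= c 0 i) -> exists c',
  [/\ (forall i, 0 <= c' 0 i), c' *m A = c *m A & lexmax (supp c')].
Proof.
move=> c0; have [c1 [c1_0 c1A ic1 _]] := reduce_support c0.
rewrite -c1A; move: c1_0 ic1; move: c1 {c c0 c1A} => c.
(* Each support carries at most one independent representation, so the number of
   lexicographically larger ones decreases at every improvement. *)
pose better c := [set S : {set 'I_N} | `[< exists c', [/\ (forall i, 0 <= c' 0 i),
  c' *m A = c *m A, indep (supp c'), supp c' = S & lexpos (c' - c)] >]].
have [n] := ubnP #|better c|; elim: n c => // n IHn c sn c0 ic.
have [gc|] := pselect (lexmax (supp c)); first by exists c; split=> //; left.
move=> /existsNP[u /not_implyP[uA /not_implyP[uS /negP/negPn u_pos]]].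
have cu i : c 0 i = 0 -> 0 <= u 0 i by move=> ci; apply: uS; rewrite inE ci eqxx.
have [t t0 ct0] := small_step c0 cu.
have [c' [c'0 c'A ic' lc']] := reduce_support ct0.
have lu := lexposZ t0 u_pos.
have {}lc' : lexpos (c' - c).
  case: lc' => [->|lc']; first by rewrite addrAC subrr add0r.
  by have := lexposD lc' lu; rewrite opprD addrA subrK.
have {}c'A : c' *m A = c *m A.
  by rewrite c'A mulmxDl -scalemxAl uA scaler0 addr0.
rewrite -c'A; apply: IHn => //; rewrite -ltnS.
apply: leq_trans sn; rewrite ltnS; apply: proper_card; apply/fintype.properP; split.
  apply/fintype.subsetP => S; rewrite !inE => /asboolP[c2 [c20 c2A ic2 Sc2 lc2]].
  apply/asboolP; exists c2; split=> //; first by rewrite c2A.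
  by have := lexposD lc2 lc'; rewrite addrA subrK.
exists (supp c'); rewrite !inE; first by apply/asboolP; exists c'.
apply/asboolP => -[c2 [c20 c2A ic2 Sc2]].
by rewrite (indep_inj c2A Sc2 ic2) subrr lexpos0.
Qed.

(** The difference of the two combinations is a relation, one of its two orientations is
    lexicographically positive, and that one is an admissible move away from the smaller
    combination. *)
Lemma lexmax_inj c c' : (forall i, 0 <= c 0 i) -> (forall i, 0 <= c' 0 i) ->
  c *m A = c' *m A -> lexmax (supp c) -> lexmax (supp c') -> c = c'.
Proof.
move=> c0 c'0 cA gc gc'; apply/eqP; rewrite -subr_eq0; apply/negPn/negP.
move=> /lexpos_total/orP[]; apply/negP.
  apply: gc'; first by rewrite mulmxBl cA subrr.
  by move=> i; rewrite inE negbK !mxE => /eqP ->; rewrite subr0.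
apply: gc; first by rewrite mulNmx mulmxBl cA subrr oppr0.
by move=> i; rewrite inE negbK !mxE => /eqP ->; rewrite sub0r opprK.
Qed.

End ConeRepresentation.

(** * Compositions of an integer *)

Section Compositions.
Variable N : nat.

Definition spread (S : {set 'I_N}) (s : seq nat) : 'rV[int]_N :=
  \row_i (if i \in S then (nth 0%N s (index i (enum S)))%:Z else 0).

(** Stars and bars, in the form of [card_ord_partitions]. Tuples over ['I_q.+1] suffice because
    nonnegative entries with sum [q] are at most [q]. *)
Lemma compositions_seq (S : {set 'I_N}) (q : nat) : (0 < #|S|)%N ->
  exists s : seq 'rV[int]_N, [/\ uniq s,
    forall n : 'rV[int]_N, n \in s <-> [/\ forall i, 0 <= n 0 i,
      forall i, i \notin S -> n 0 i = 0 & \sum_i n 0 i = q%:Z] &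
    size s = 'C(#|S|.-1 + q, #|S|.-1)].
Proof.
move=> S_gt0; set r := #|S|.-1; have Sr : #|S| = r.+1 by rewrite /r prednK.
pose T := [set t : r.+1.-tuple 'I_q.+1 | (\sum_(i <- t) i == q)%N].
pose F (t : r.+1.-tuple 'I_q.+1) := spread S (map val t).
have szS : size (enum S) = r.+1 by rewrite -cardE.
have Fsum (t : r.+1.-tuple 'I_q.+1) : \sum_i F t 0 i = (\sum_(i <- t) i)%N%:Z.
  rewrite (eq_bigr (fun i => if i \in S then F t 0 i else 0)); last first.
    by move=> i _; rewrite mxE; case: ifP.
  have [i0 _] := card_gt0P S_gt0.
  rewrite -big_mkcond -big_enum (big_nth i0) szS big_mkord.
  rewrite (big_nth ord0) size_tuple big_mkord -[RHS]natz natr_sum.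
  apply: eq_bigr => j _; rewrite mxE -mem_enum mem_nth ?szS //.
  rewrite index_uniq ?enum_uniq ?szS // (nth_map ord0) ?size_tuple //.
  by rewrite natz.
have Finj : injective F.
  move=> t t' /rowP tt'; apply: val_inj; apply: (inj_map val_inj).
  apply: (@eq_from_nth _ 0%N); rewrite !size_map !size_tuple // => j jr.
  have [i0 _] := card_gt0P S_gt0.
  have jS : (j < size (enum S))%N by rewrite szS.
  have := tt' (nth i0 (enum S) j); rewrite !mxE.
  by rewrite -mem_enum mem_nth // index_uniq ?enum_uniq // => -[].
exists [seq F t | t <- enum T]; split.
- by rewrite map_inj_uniq ?enum_uniq.
- move=> n; split.
    case/mapP => t; rewrite mem_enum inE => /eqP tq ->; split.
    + by move=> i; rewrite mxE; case: ifP.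
    + by move=> i /negPf iS; rewrite mxE iS.
    + by rewrite Fsum tq.
  case=> n0 nS nq.
  pose s := [seq inord (absz (n 0 i)) : 'I_q.+1 | i <- enum S].
  have szs : size s == r.+1 by rewrite size_map szS.
  have nle i : (absz (n 0%R i) < q.+1)%N.
    rewrite ltnS -lez_nat gez0_abs // -nq (bigD1 i) //= lerDl.
    by rewrite sumr_ge0.
  have Fn : F (Tuple szs) = n.
    apply/rowP => i; rewrite mxE; case: ifP => iS; last by rewrite nS ?iS.
    have iS' : (index i (enum S) < size (enum S))%N by rewrite index_mem mem_enum.
    rewrite /= (nth_map ord0) ?size_map // (nth_map i) // nth_index ?mem_enum //.
    by rewrite inordK ?nle // gez0_abs.
  rewrite -Fn map_f // mem_enum inE -eqz_nat -Fsum Fn.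
  exact/eqP.
- by rewrite size_map -cardE card_ord_partitions.
Qed.

(** The binomial coefficient of X - d + r over r, as a polynomial in X. *)
Definition binomial_poly (r d : nat) : {poly rat} :=
  (r`!%:R)^-1 *: \prod_(j < r) ('X + (j.+1%:R - d%:R)%:P).

(* The bound on [d] is sharp: it makes the polynomial vanish at [0 < m < d]. *)
Lemma binomial_polyE (r d m : nat) : (d <= r.+1)%N -> (0 < m)%N ->
  (binomial_poly r d).[m%:R] = (if (d <= m)%N then 'C(r + (m - d), r) else 0)%:R.
Proof.
move=> dr m0; rewrite /binomial_poly hornerZ horner_prod.
under eq_bigr do rewrite hornerD hornerX hornerC.
have rf : r`!%:R != 0 :> rat by rewrite pnatr_eq0 -lt0n fact_gt0.
case: leqP => dm; last first.
  have jr : (d - m.+1 < r)%N by lia.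
  rewrite (bigD1 (Ordinal jr)) //= (_ : _ + _ = 0) ?mul0r ?mulr0 //.
  by rewrite subnSK // natrB 1?ltnW // addrA addrC addrCA; ring.
apply: (mulfI rf); rewrite mulrA divff // mul1r -natrM mulnC bin_ffact.
have -> : \prod_(i < r) (m%:R + (i.+1%:R - d%:R)) =
         \prod_(i < r) (m - d + i.+1)%:R :> rat.
  by apply: eq_bigr => i _; rewrite natrD natrB //; ring.
rewrite -natr_prod; congr _%:R; elim: r {dr rf} => [|r IHr].
  by rewrite big_ord0 ffactn0.
by rewrite big_ord_recr /= IHr addSn ffactSS mulnC addnS addnC.
Qed.

Lemma compositions_poly (S : {set 'I_N}) (d : nat) : (d <= #|S|)%N ->
  exists p : {poly rat}, forall m, (0 < m)%N -> exists s : seq 'rV[int]_N,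
    [/\ uniq s,
      forall n : 'rV[int]_N, n \in s <-> [/\ forall i, 0 <= n 0 i,
        forall i, i \notin S -> n 0 i = 0 & \sum_i n 0 i + d%:Z = m%:Z] &
      p.[m%:R] = (size s)%:R].
Proof.
(* On the empty support [d = 0] and the only composition has total 0, so none occurs for [m > 0] and
   the zero polynomial counts them. *)
move=> dS; have [S0|S0] := eqVneq S finset.set0.
  exists 0 => m m0; exists [::]; split=> //; last by rewrite horner0.
  move=> n; split=> // -[_ nS]; rewrite big1; last by move=> i _; rewrite nS ?S0 ?inE.
  by move: dS m0; rewrite S0 cards0; lia.
have S_gt0 : (0 < #|S|)%N by rewrite card_gt0.
exists (binomial_poly #|S|.-1 d) => m m0.
rewrite binomial_polyE ?prednK //; case: leqP => dm; last first.
  exists [::]; split=> // n; split=> // -[n0 _].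
  have : 0 <= \sum_i n 0 i by rewrite sumr_ge0.
  lia.
have [s [us sP ss]] := compositions_seq (m - d) S_gt0.
exists s; split=> //; last by rewrite ss.
move=> n; rewrite sP; split=> -[n0 nS nq]; split=> //; lia.
Qed.

End Compositions.

(** * Lattice points in cones *)

Lemma map_intr_inj (R : numDomainType) m n :
  injective (map_mx intr : 'M[int]_(m, n) -> 'M[R]_(m, n)).
Proof.
move=> z z' /matrixP zz'; apply/matrixP => i j; have := zz' i j.
by rewrite !mxE => /eqP; rewrite eqr_int => /eqP.
Qed.

Lemma finite_bounded_row K (M : nat) :
  finite_set (fun z : 'rV[int]_K => forall j, `|z 0 j| <= M%:Z).
Proof.
pose g (t : {ffun 'I_K -> 'I_(M + M).+1}) : 'rV[int]_K :=
  \row_j ((t j : nat)%:Z - M%:Z).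
apply: (@sub_finite_set _ _ (range g)); last exact/finite_image/finite_finset.
move=> z zM; exists [ffun j => inord (absz (z 0 j + M%:Z))] => //.
apply/rowP => j; rewrite mxE ffunE; have := zM j => zj.
rewrite inordK; lia.
Qed.

Section ConeCounting.
Variables (R : realType) (N K : nat) (A : 'M[int]_(N, K)) (h : 'cV[int]_K).
Hypothesis Ah : A *m h = const_mx 1.

Local Notation AR := (map_mx intr A : 'M[R]_(N, K)).
Local Notation hR := (map_mx intr h : 'cV[R]_K).

Let AhR : AR *m hR = const_mx 1.
Proof. by rewrite -map_mxM Ah; apply/matrixP => i j; rewrite !mxE. Qed.

(* On their support these coefficients lie in ]0, 1] rather than [0, 1[, so that the
   height is at most [#|supp f|], as [compositions_poly] requires. *)
Definition box (f : 'rV[R]_N) : Prop :=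
  [/\ lexmax AR (supp f), forall i, 0 <= f 0 i <= 1 &
      exists z : 'rV[int]_K, f *m AR = map_mx intr z].

(** A point of the box is recovered from the integral point [f *m AR] by [lexmax_inj], and these
    integral points are bounded since all coefficients are at most 1. The function [g] is this
    inverse. *)
Lemma finite_box : finite_set box.
Proof.
pose M := \max_j \sum_i absz (A i j).
pose Z := (fun z : 'rV[int]_K => forall j, `|z 0 j| <= M%:Z).
pose g z := xget 0 (fun f => box f /\ f *m AR = map_mx intr z).
apply: (@sub_finite_set _ _ (g @` Z)%classic); last exact/finite_image/finite_bounded_row.
move=> f bf; have [gf f01 [z fz]] := bf; exists z.
  move=> j; rewrite -(ler_int R) intr_norm.
  have -> : (z 0 j)%:~R = (f *m AR) 0 j by rewrite fz mxE.
  rewrite mxE (le_trans (ler_norm_sum _ _ _)) //.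
  have le1 : \sum_i `|f 0 i * AR i j| <= (\sum_i absz (A i j))%N%:R.
    rewrite natr_sum ler_sum // => i _; rewrite normrM mxE.
    have /andP[f0 f1] := f01 i; rewrite (ger0_norm f0) -intr_norm.
    by rewrite natr_absz ler_piMl // ler0z.
  apply: le_trans le1 _; rewrite -pmulrn ler_nat /M.
  exact: (leq_bigmax j).
rewrite /g; case: xgetP => [f' _ [[gf' f'01 _] f'z]|/(_ f)[]//].
apply: (lexmax_inj (A := AR)); rewrite ?fz ?f'z //.
  by move=> i; case/andP: (f'01 i).
by move=> i; case/andP: (f01 i).
Qed.

Lemma box_decomposition (c : 'rV[R]_N) : (forall i, 0 <= c 0 i) ->
  exists n : 'rV[int]_N, [/\ forall i, 0 <= n 0 i,
    forall i, c 0 i = 0 -> n 0 i = 0,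
    supp (c - map_mx intr n) = supp c &
    forall i, 0 <= (c - map_mx intr n) 0 i <= 1].
Proof.
(* The ceiling minus 1, instead of the floor, leaves a remainder in ]0, 1] wherever [c] is positive,
   so the support does not shrink. *)
move=> c0; exists (\row_i (if c 0 i == 0 then 0 else Num.ceil (c 0 i) - 1)).
have cpos i : c 0 i != 0 -> 0 < c 0 i by rewrite lt_def c0 andbT.
have bnd i : c 0 i != 0 -> 0 < c 0 i - (Num.ceil (c 0 i) - 1)%:~R <= 1.
  move=> /cpos ci; have /andP[] := ceil_itv (c 0 i).
  by rewrite intrB => h1 h2; apply/andP; split; lra.
split=> [i|i ci||i]; rewrite ?mxE.
- case: ifPn => // /cpos ci; rewrite subr_ge0.
  by rewrite -gtz0_ge1 ceil_gt0.
- by rewrite ci eqxx.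
- apply/setP => i; rewrite !inE !mxE; case: ifPn => [/eqP ->|ci].
    by rewrite subr0 eqxx.
  by have /andP[h1 _] := bnd i ci; rewrite gt_eqF.
- case: ifPn => [/eqP ->|/bnd/andP[h1 h2]]; first by rewrite subr0 lexx ler01.
  by rewrite (ltW h1) h2.
Qed.

(** The height is the sum of the coefficients of [f], each of which is at most 1. *)
Lemma box_height (f : 'rV[R]_N) (z : 'rV[int]_K) : box f ->
  f *m AR = map_mx intr z ->
  exists2 d : nat, (d <= #|supp f|)%N & (z *m h) 0 0 = d%:Z.
Proof.
move=> [_ f01 _] fz; have := height AhR f.
rewrite fz -map_mxM => /matrixP/(_ 0 0).
rewrite [LHS]mxE [RHS]mxE mulr1n => hz.
have s0 : 0 <= \sum_i f 0 i by rewrite sumr_ge0 // => i _; case/andP: (f01 i).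
have d0 : 0 <= (z *m h) 0 0 by rewrite -(ler_int R) hz.
exists (absz ((z *m h) 0 0)); last by rewrite gez0_abs.
rewrite -(ler_nat R) natr_absz ger0_norm //.
rewrite hz (bigID (mem (supp f))) /= [X in _ + X]big1 ?addr0; last first.
  by move=> i; rewrite inE negbK => /eqP.
rewrite -sum1_card natr_sum ler_sum // => i _.
by case/andP: (f01 i).
Qed.

Definition in_cone (z : 'rV[int]_K) :=
  exists2 c : 'rV[R]_N, (forall i, 0 <= c 0 i) & c *m AR = map_mx intr z.

(** Every integral point of the cone is [(f + n) *m A] for exactly one [f] in the finite box and one
    nonnegative integral [n] supported in [supp f]. At height [m] the entries of [n] add up to [m]
    minus the height of [f], so each [f] contributes one polynomial. *)
Lemma cone_ehrhart : exists p : {poly rat}, forall m, (0 < m)%N ->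
  exists s : seq 'rV[int]_K, [/\ uniq s,
    forall z, z \in s <-> in_cone z /\ (z *m h) 0 0 = m%:Z &
    p.[m%:R] = (size s)%:R].
Proof.
have [fs0 fs0P] := (finite_seqP box).1 finite_box.
pose fs := undup fs0.
have fsP f : f \in fs <-> box f by rewrite mem_undup fs0P.
have hf f : exists zp : 'rV[int]_K * {poly rat}, box f ->
  f *m AR = map_mx intr zp.1 /\
  forall m, (0 < m)%N -> exists s : seq 'rV[int]_N,
    [/\ uniq s,
      forall n : 'rV[int]_N, n \in s <-> [/\ forall i, 0 <= n 0 i,
        forall i, i \notin supp f -> n 0 i = 0 &
        \sum_i n 0 i + (zp.1 *m h) 0 0 = m%:Z] &
      zp.2.[m%:R] = (size s)%:R].
  have [bf|nbf] := pselect (box f); last by exists (0, 0).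
  have [_ _ [z fz]] := bf; have [d dS hz] := box_height bf fz.
  have [p pP] := compositions_poly dS; exists (z, p) => _ /=; split=> //.
  by rewrite hz.
have {hf}[zp zpP] := choice hf.
exists (\sum_(f <- fs) (zp f).2) => m m0.
have hs f : exists s : seq 'rV[int]_N, box f -> [/\ uniq s,
      forall n : 'rV[int]_N, n \in s <-> [/\ forall i, 0 <= n 0 i,
        forall i, i \notin supp f -> n 0 i = 0 &
        \sum_i n 0 i + ((zp f).1 *m h) 0 0 = m%:Z] &
      (zp f).2.[m%:R] = (size s)%:R].
  have [bf|nbf] := pselect (box f); last by exists [::].
  by have [_ /(_ m m0)[s sP]] := zpP f bf; exists s.
have {hs}[s sP] := choice hs.
have suppD f (n : 'rV[int]_N) : box f -> n \in s f ->
    supp (f + map_mx intr n) = supp f /\ (forall i, 0 <= (f + map_mx intr n) 0 i).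
  move=> bf; have [_ f01 _] := bf; have [_ nP _] := sP f bf.
  move=> /nP[n0 nS _]; have nR i : 0 <= (n 0 i)%:~R :> R by rewrite ler0z.
  split; last by move=> i; rewrite !mxE addr_ge0 //; case/andP: (f01 i).
  apply/setP => i; rewrite !inE !mxE.
  have [fi|fi] := eqVneq (f 0 i) 0; last first.
    by rewrite gt_eqF // ltr_pwDl // lt_def fi; case/andP: (f01 i).
  by rewrite fi nS ?inE ?fi ?eqxx // addr0 eqxx.
exists [seq (zp f).1 + n *m A | f <- fs, n <- s f]; split.
- apply: allpairs_uniq_dep.
  + exact: undup_uniq.
  + by move=> f /fsP/sP[].
  move=> _ _ /allpairsPdep[f [n [/fsP bf nf ->]]] /allpairsPdep[f' [n' [/fsP bf' nf' ->]]] /=.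
  move=> /(congr1 (map_mx (intr : int -> R))).
  have [fz _] := zpP f bf; have [fz' _] := zpP f' bf'.
  rewrite !map_mxD !map_mxM -fz -fz' -!mulmxDl => eqA.
  have [s1 s1_0] := suppD _ _ bf nf; have [s2 s2_0] := suppD _ _ bf' nf'.
  have [g1 f01 _] := bf; have [g2 f'01 _] := bf'.
  have cc : f + map_mx intr n = f' + map_mx intr n'.
    by apply: (lexmax_inj (A := AR)); rewrite ?s1 ?s2.
  have sff' : supp f = supp f' by rewrite -s1 -s2 cc.
  have [_ nP _] := sP f bf; have [_ n'P _] := sP f' bf'.
  have [_ nS _] := (nP n).1 nf; have [_ n'S _] := (n'P n').1 nf'.
  (* On the common support [f 0 i] and [f' 0 i] both lie in ]0, 1], so the integers [n 0 i] and
     [n' 0 i] differ by less than 1. *)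
  have nn' : n = n'.
    apply/rowP => i; have /rowP/(_ i) := cc; rewrite !mxE => ci.
    have [iS|iS] := boolP (i \in supp f); last by rewrite nS ?n'S -?sff'.
    have fi : 0 < f 0 i by rewrite lt_def; have := f01 i; rewrite inE in iS; rewrite iS => /andP[].
    have f'i : 0 < f' 0 i.
      by rewrite lt_def; have := f'01 i; rewrite sff' inE in iS; rewrite iS => /andP[].
    have /andP[_ fi1] := f01 i; have /andP[_ f'i1] := f'01 i.
    apply/eqP; rewrite eq_le -!ltzD1 -!(ltr_int R) !intrD.
    by apply/andP; split; lra.
  by move: cc; rewrite nn' => /addIr ->.
- move=> z; split.
    move=> /allpairsPdep[f [n [/fsP bf nf ->]]].
    have [s1 s1_0] := suppD _ _ bf nf; have [fz _] := zpP f bf.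
    have [_ nP _] := sP f bf; have [n0 nS nm] := (nP n).1 nf; split.
      by exists (f + map_mx intr n) => //; rewrite mulmxDl fz map_mxD map_mxM.
    rewrite mulmxDl -mulmxA Ah mxE addrC -nm; congr (_ + _).
    by rewrite mxE; apply: eq_bigr => i _; rewrite mxE mulr1.
  move=> [[c c0 cz] zm].
  have [c' [c'0 c'A gc']] := lexmax_representation AhR c0.
  have [n [n0 nc nsupp f01]] := box_decomposition c'0.
  set f := c' - _ in nsupp f01.
  have fA : f *m AR = map_mx intr (z - n *m A).
    by rewrite mulmxBl c'A cz -map_mxM -map_mxB.
  have bf : box f by split=> //; [rewrite nsupp|exists (z - n *m A)].
  have [fz _] := zpP f bf; have [_ nP _] := sP f bf.
  have zE : (zp f).1 = z - n *m A by apply: (map_intr_inj (R := R)); rewrite -fz.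
  apply/allpairsPdep; exists f, n; split; first exact/fsP.
    apply/nP; split=> // [i|].
      by rewrite nsupp inE negbK => /eqP /nc.
    rewrite zE mulmxBl -mulmxA Ah !mxE -zm mxE addrCA -[RHS]addr0; congr (_ + _).
    by apply/eqP; rewrite subr_eq0; apply/eqP; apply: eq_bigr => i _; rewrite mxE mulr1.
  by rewrite zE subrK.
- rewrite horner_sum size_allpairs_dep sumnE big_map natr_sum !big_seq.
  by apply: eq_bigr => f /fsP /sP[].
Qed.

End ConeCounting.

(** * Ehrhart's theorem *)

(** Bridge from cardinalities of sets to duplicate-free lists, on which the counting is carried
    out. *)
Lemma card_eq_seq (T : choiceType) (A : set T) (n : nat) :
  (A #= `I_n)%card <-> exists s : seq T, [/\ uniq s, forall x, x \in s <-> A x & size s = n].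
Proof.
split=> [An|[s [us sA <-]]].
  exists (fset_set A); split; rewrite ?fset_uniq //; last exact: card_fset_set.
  have fA : finite_set A by exists n.
  by move=> x; rewrite -[X in _ <-> X x](fset_setK fA).
have fA : finite_set A.
  by apply/finite_seqP; exists s; apply/seteqP; split=> x /= /sA.
have [m Am] := fA; suff <- : m = size s by [].
rewrite -(card_fset_set Am); apply: perm_size.
apply: uniq_perm => [//|//|x]; rewrite in_fset_set //.
by apply/idP/idP; rewrite in_setE => /sA.
Qed.

Section ConvexHull.
Variables (R : realType) (k : nat).

Lemma convex_combination (D : set 'rV[R]_k) : @convex_set R 'rV[R]_k D ->
  forall N (v : 'I_N -> 'rV[R]_k) (c : 'I_N -> R),
    (forall i, D (v i)) -> (forall i, 0 <= c i) -> \sum_i c i = 1 ->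
    D (\sum_i c i *: v i).
Proof.
move=> Dc; elim=> [|N IHN] v c Dv c0 c1.
  by move: c1; rewrite big_ord0 => /eqP; rewrite eq_sym oner_eq0.
rewrite big_ord_recl; move: c1; rewrite big_ord_recl.
set t := \sum_(i < N) _; set w := \sum_(i < N) _ => c1.
have t0 : 0 <= t by apply: sumr_ge0.
have [t_eq0|t_neq0] := eqVneq t 0.
  have -> : w = 0.
    rewrite /w big1 // => i _; have /eqP := t_eq0.
    rewrite psumr_eq0 // => /allP/(_ i); rewrite mem_index_enum => /(_ isT)/eqP ->.
    by rewrite scale0r.
  by rewrite addr0; move: c1; rewrite t_eq0 addr0 => ->; rewrite scale1r.
have c0_le1 : c ord0 <= 1 by rewrite -c1 lerDl.
have Dw : D (t^-1 *: w).
  rewrite /w scaler_sumr; under eq_bigr do rewrite scalerA.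
  apply: IHN => // [i|]; first by rewrite mulr_ge0 ?invr_ge0.
  by rewrite -mulr_sumr mulVf.
have := Dc (v ord0) (t^-1 *: w) (Itv01 (c0 ord0) c0_le1).
rewrite !in_setE => /(_ (Dv _) Dw); congr (D _).
rewrite /conv /=; congr (_ + _); rewrite /unstable.onem -c1 addrAC subrr add0r.
by rewrite scalerA divff // scale1r.
Qed.

Lemma convex_hullP N (V : 'M[R]_(N, k)) (x : 'rV[R]_k) :
  convex_hull (range (fun i => row i V)) x <->
  exists c : 'rV[R]_N, [/\ forall i, 0 <= c 0 i, \sum_i c 0 i = 1 & x = c *m V].
Proof.
split.
  apply: (@smallest_sub _ _ (range (fun i => row i V))%classic
    [set x | exists c : 'rV[R]_N, [/\ forall i, 0 <= c 0 i, \sum_i c 0 i = 1 &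
      x = c *m V]]%classic).
    move=> y z t; rewrite !in_setE => -[c [c0 c1 ->]] -[c' [c'0 c'1 ->]].
    exists (t%:num *: c + (1 - t%:num) *: c'); split.
    - by move=> i; rewrite !mxE addr_ge0 // mulr_ge0 // subr_ge0.
    - under eq_bigr do rewrite !mxE.
      by rewrite big_split -!mulr_sumr c1 c'1 /= !mulr1 addrC subrK.
    - by rewrite mulmxDl -!scalemxAl.
  move=> _ [i _ <-]; exists (delta_mx 0 i); split; last by rewrite rowE.
    by move=> j; rewrite mxE ler0n.
  rewrite (bigD1 i) //= mxE !eqxx big1 ?addr0 // => j /negPf ji.
  by rewrite mxE ji andbF.
move=> [c [c0 c1 ->]] D [Dc DV]; rewrite mulmx_sum_row.
by apply: convex_combination => // i; apply: DV; exists i.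
Qed.

End ConvexHull.

Lemma lattice_polytopeP (R : realType) k (P : set 'rV[R]_k) :
  lattice_polytope P -> exists N (V : 'M[int]_(N, k)), forall x,
    P x <-> exists c : 'rV[R]_N,
      [/\ forall i, 0 <= c 0 i, \sum_i c 0 i = 1 & x = c *m map_mx intr V].
Proof.
move=> [W /finite_seqP[s ->] ->].
exists (size s), (\matrix_(i < size s) nth 0 s i) => x.
rewrite -convex_hullP; suff -> : [set map_mx intr v | v in [set` s]]%classic =
  range (fun i => row i (map_mx intr (\matrix_(i < size s) nth 0 s i) : 'M[R]_(_, _))) by [].
apply/seteqP; split=> y [].
  move=> v /= vs <-; have vs' : (index v s < size s)%N by rewrite index_mem.
  exists (Ordinal vs') => //; rewrite -map_row rowK /= nth_index //.
by move=> i _ <-; exists (nth 0 s i); [exact: mem_nth|rewrite -map_row rowK].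
Qed.

Lemma ratr_intmx (R : realType) m n (z : 'M[int]_(m, n)) :
  map_mx ratr (map_mx intr z : 'M[rat]_(m, n)) = map_mx intr z :> 'M[R]_(m, n).
Proof. by apply/matrixP => i j; rewrite !mxE ratr_int. Qed.

Lemma Zlattice_matrix k N (B : 'M[rat]_k) (V : 'M[int]_(N, k)) : B \in unitmx ->
  (Zlattice k `<=` row_span B)%classic ->
  exists V' : 'M[int]_(N, k), map_mx intr V = map_mx intr V' *m B.
Proof.
move=> uB ZB.
have rV i : exists z : 'rV[int]_k, map_mx intr (row i V) = map_mx intr z *m B.
  have /ZB[z _ <-] : Zlattice k (map_mx intr (row i V)) by exists (row i V).
  by exists z.
have [g gV] := choice rV; exists (\matrix_(i < N) g i).
by apply/row_matrixP => i; rewrite row_mul -!map_row rowK gV.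
Qed.

(** In coordinates with respect to a basis [B] of L the vertices remain integral, because L contains
    Z^k. Appending a coordinate 1 to each of them, which [h] reads off, turns the points of mP in L
    into the integral points of height [m] of a cone. *)
Theorem ehrhart_exists (R : realType) k (P : set 'rV[R]_k) (L : set 'rV[rat]_k) :
  lattice_polytope P -> is_lattice L -> (Zlattice k `<=` L)%classic ->
  exists E, is_ehrhart P L E.
Proof.
move=> /lattice_polytopeP[N [V PV]] [B uB ->] ZB.
have [V' VV'] := Zlattice_matrix V uB ZB.
pose A := row_mx V' (const_mx 1 : 'cV[int]_N).
pose h : 'cV[int]_(k + 1) := col_mx 0 (const_mx 1).
have Ah : A *m h = const_mx 1.
  rewrite mul_row_col mulmx0 add0r; apply/matrixP => i j.
  by rewrite !mxE big_ord1 !mxE mulr1.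
have [E EP] := cone_ehrhart R Ah; exists E => m m0.
have [s [us sP ->]] := EP m m0; exists (size s) => //.
apply/card_eq_seq; exists [seq map_mx intr (lsubmx z) *m B | z <- s].
have sz z : z \in s -> rsubmx z = const_mx m%:Z.
  move=> /sP[_ zm]; apply/matrixP => i j; rewrite !ord1.
  by move: zm; rewrite -{1}[z]hsubmxK mul_row_col mulmx0 add0r !mxE big_ord1 !mxE mulr1.
split; last by rewrite size_map.
  rewrite map_inj_in_uniq // => z z' /sz zs /sz z's.
  move=> /(congr1 (mulmx^~ (invmx B))); rewrite !mulmxK // => zz'.
  rewrite -[z]hsubmxK -[z']hsubmxK zs z's; congr row_mx.
  apply/matrixP => i j; have /matrixP/(_ i j) := zz'.
  by rewrite !mxE => /eqP; rewrite eqr_int => /eqP.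
have mR : m%:R != 0 :> R by rewrite pnatr_eq0 -lt0n.
have uBR : (map_mx ratr B : 'M[R]_k) \in unitmx by rewrite map_unitmx.
have VR : map_mx intr V = map_mx intr V' *m map_mx ratr B :> 'M[R]_(_, _).
  by rewrite -!ratr_intmx VV' map_mxM.
have sumE (c : 'rV[R]_N) : c *m const_mx 1 = (\sum_i c 0 i)%:M :> 'M_1.
  apply/matrixP => i j; rewrite !ord1 !mxE mulr1n.
  by apply: eq_bigr => l _; rewrite mxE mulr1.
move=> x; split.
  move=> /mapP[z zs ->]; have [[c c0 cz] zm] := (sP z).1 zs.
  split; first by exists (lsubmx z).
  move: cz; rewrite -[z in RHS]hsubmxK (sz z zs) !map_row_mx mul_mx_row.
  move=> /eq_row_mx[cV]; rewrite !map_const_mx rmorph1 sumE => /matrixP/(_ 0 0).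
  rewrite !mxE mulr1n -pmulrn => c1.
  exists (m%:R^-1 *: c *m map_mx intr V); last first.
    by rewrite -scalemxAl scalerA divff // scale1r VR mulmxA cV map_mxM ratr_intmx.
  apply/PV; exists (m%:R^-1 *: c); split=> // [i|].
    by rewrite mxE mulr_ge0 // invr_ge0 ler0n.
  by under eq_bigr do rewrite mxE; rewrite -mulr_sumr c1 mulVf.
move=> [[z _ <-]] [p /PV[c [c0 c1 ->]]].
rewrite map_mxM ratr_intmx VR mulmxA scalemxAl => /(congr1 (mulmx^~ (invmx (map_mx ratr B)))).
rewrite !mulmxK // scalemxAl => cz.
apply/mapP; exists (row_mx z (const_mx m%:Z)); last by rewrite row_mxKl.
apply/sP; split; last first.
  by rewrite mul_row_col mulmx0 add0r !mxE big_ord1 !mxE mulr1.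
exists (m%:R *: c); first by move=> i; rewrite mxE mulr_ge0 // ler0n.
rewrite !map_row_mx mul_mx_row cz !map_const_mx rmorph1 sumE; congr row_mx.
apply/matrixP => i j; rewrite !ord1 !mxE mulr1n -pmulrn.
by under eq_bigr do rewrite mxE; rewrite -mulr_sumr c1 mulr1.
Qed.

Lemma ehrhart_polyP (R : realType) k (P : set 'rV[R]_k) (L : set 'rV[rat]_k) :
  lattice_polytope P -> is_lattice L -> (Zlattice k `<=` L)%classic ->
  is_ehrhart P L (ehrhart_poly P L).
Proof. by move=> PP LL ZL; have := ehrhart_exists PP LL ZL; exact: xgetPex. Qed.

(** * Superlattices and their torsion parts *)

Section Superlattices.
Variable k : nat.
Implicit Types (L K : set 'rV[rat]_k) (x y : 'rV[rat]_k).

Local Notation Z := (Zlattice k).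

(** A subgroup of Q^k containing Z^k, with no basis required: torsion parts and sums then stay in
    the class at no cost, and [superlattice_is_lattice] supplies a basis when the torsion is
    bounded. *)
Definition superlattice L := (Z `<=` L)%classic /\ forall x y, L x -> L y -> L (x - y).

Lemma ZlatticeB x y : Z x -> Z y -> Z (x - y).
Proof. by move=> [z _ <-] [t _ <-]; exists (z - t); rewrite ?map_mxB. Qed.

Lemma superlatticeZ : superlattice Z.
Proof. by split=> //; exact: ZlatticeB. Qed.

Lemma superlattice0 L : superlattice L -> L 0.
Proof. by move=> [ZL _]; apply: ZL; exists 0; rewrite ?map_mx0. Qed.

Lemma superlatticeN L x : superlattice L -> L x -> L (- x).
Proof. by move=> SL Lx; rewrite -sub0r; apply: SL.2 => //; exact: superlattice0 SL. Qed.

Lemma superlatticeD L x y : superlattice L -> L x -> L y -> L (x + y).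
Proof. by move=> SL Lx Ly; rewrite -[y]opprK; apply: SL.2 => //; exact: superlatticeN SL Ly. Qed.

Lemma superlatticeMz L x (n : int) : superlattice L -> L x -> L (x *~ n).
Proof.
move=> SL Lx; have Ln m : L (x *+ m).
  elim: m => [|m IHm]; first by rewrite mulr0n; exact: superlattice0.
  by rewrite mulrS; exact: superlatticeD.
by case: n => n; [exact: Ln|rewrite NegzE mulrNz; apply: superlatticeN => //; exact: Ln].
Qed.

Lemma superlatticeMn L x (n : nat) : superlattice L -> L x -> L (x *+ n).
Proof. by move=> SL Lx; rewrite pmulrn; exact: superlatticeMz. Qed.

Lemma superlattice_dvd L x (d m : nat) : superlattice L -> (d %| m)%N ->
  L (x *+ d) -> L (x *+ m).
Proof. by move=> SL /dvdnP[q ->] Lx; rewrite mulnC mulrnA; exact: superlatticeMn. Qed.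

(** For [L = setT] this is the lattice (1/m) Z^k. *)
Definition torsion_part L (m : nat) : set 'rV[rat]_k := [set x | L x /\ Z (x *+ m)]%classic.

Definition join_lattice L K : set 'rV[rat]_k :=
  [set x | exists p q, [/\ L p, K q & x = p + q]]%classic.

Lemma superlattice_torsion L m : superlattice L -> superlattice (torsion_part L m).
Proof.
move=> SL; split=> [x Zx|x y [Lx Zx] [Ly Zy]]; split.
- exact: SL.1.
- exact: superlatticeMn _ superlatticeZ _.
- exact: SL.2.
- by rewrite mulrnBl; exact: ZlatticeB.
Qed.

Lemma superlattice_join L K : superlattice L -> superlattice K ->
  superlattice (join_lattice L K).
Proof.
move=> SL SK; split=> [x Zx|_ _ [p [q [Lp Kq ->]]] [p' [q' [Lp' Kq' ->]]]].
  exists x, 0; split; [exact: SL.1|exact: superlattice0|by rewrite addr0].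
exists (p - p'), (q - q'); split; [exact: SL.2|exact: SK.2|].
by rewrite opprD addrACA.
Qed.

(** * Torsion parts for coprime moduli *)

Section Coprime.
Variables (a b : nat) (u v : int).
Hypothesis uv : u * a%:Z + v * b%:Z = 1.

Let bezout x : x = x *~ (v * b%:Z) + x *~ (u * a%:Z).
Proof. by rewrite -mulrzDr addrC uv. Qed.

(** Multiplication by [v * b] annihilates [K] modulo Z^k and is the identity on [L] modulo Z^k, and
    symmetrically for [u * a]. Membership in the sum thus becomes two independent conditions on the
    components of [x], and its indicator a product. *)
Lemma join_latticeE L K x : superlattice L -> superlattice K ->
  (forall y, L y -> Z (y *+ a)) -> (forall y, K y -> Z (y *+ b)) ->
  join_lattice L K x <-> L (x *~ (v * b%:Z)) /\ K (x *~ (u * a%:Z)).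
Proof.
move=> SL SK La Kb; split; last first.
  by move=> [Lx Kx]; exists (x *~ (v * b%:Z)), (x *~ (u * a%:Z)); split.
move=> [p [q [Lp Kq ->]]]; rewrite !mulrzDl; split.
  apply: superlatticeD => //; first exact: superlatticeMz.
  rewrite mulrC mulrzA -pmulrn; apply: superlatticeMz => //; apply: SL.1.
  exact: Kb.
apply: superlatticeD => //; last exact: superlatticeMz.
rewrite mulrC mulrzA -pmulrn; apply: superlatticeMz => //; apply: SK.1.
exact: La.
Qed.

Lemma join_torsion L : superlattice L -> (forall y, L y -> Z (y *+ (a * b))) ->
  join_lattice (torsion_part L a) (torsion_part L b) = L.
Proof.
move=> SL Lab; apply/seteqP; split=> [_ [p [q [[Lp _] [Lq _] ->]]]|x Lx].
  exact: superlatticeD.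
have Zx := Lab x Lx; exists (x *~ (v * b%:Z)), (x *~ (u * a%:Z)).
split=> //; split; try exact: superlatticeMz.
  rewrite (_ : _ *+ a = x *+ (a * b) *~ v); first exact: superlatticeMz _ superlatticeZ _.
  by rewrite !pmulrn -!mulrzA PoszM; congr (_ *~ _); ring.
rewrite (_ : _ *+ b = x *+ (a * b) *~ u); first exact: superlatticeMz _ superlatticeZ _.
by rewrite !pmulrn -!mulrzA PoszM; congr (_ *~ _); ring.
Qed.

Lemma torsion_join L K : superlattice L -> superlattice K ->
  (forall y, L y -> Z (y *+ a)) -> (forall y, K y -> Z (y *+ b)) ->
  torsion_part (join_lattice L K) a = L.
Proof.
move=> SL SK La Kb; apply/seteqP; split=> [x []|x Lx].
  move=> /(join_latticeE _ SL SK La Kb)[Lx _] Zx.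
  rewrite (bezout x); apply: superlatticeD => //.
  rewrite mulrC mulrzA -pmulrn; apply: superlatticeMz => //.
  exact: SL.1.
split; last exact: La.
by exists x, 0; split=> //; [exact: superlattice0|rewrite addr0].
Qed.

End Coprime.

Lemma join_latticeC L K : join_lattice L K = join_lattice K L.
Proof.
by apply/seteqP; split=> x [p [q [Lp Kq ->]]]; exists q, p; rewrite addrC.
Qed.

Lemma lattice_superlattice L : is_lattice L -> (Z `<=` L)%classic -> superlattice L.
Proof.
move=> [B _ ->] ZL; split=> // _ _ [z _ <-] [t _ <-].
by exists (z - t); rewrite ?map_mxB ?mulmxBl.
Qed.

Lemma exists_order x (m : nat) : (0 < m)%N -> Z (x *+ m) ->
  exists2 d : nat, (0 < d)%N & forall j : nat, Z (x *+ j) <-> (d %| j)%N.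
Proof.
move=> m0 Zm; pose Q d := (0 < d)%N && `[< Z (x *+ d) >].
have exQ : exists d, Q d by exists m; rewrite /Q m0; apply/asboolP.
have [d /andP[d0 /asboolP Zd] dmin] := ex_minnP exQ; exists d => // j; split.
  move=> Zj; rewrite /dvdn; have [//|r0] := posnP (j %% d).
  have : Q (j %% d)%N.
    rewrite /Q r0; apply/asboolP.
    have -> : x *+ (j %% d) = x *+ j - x *+ (j %/ d * d).
      by rewrite {2}(divn_eq j d) mulrnDr addrAC subrr add0r.
    by apply: ZlatticeB => //; exact: superlattice_dvd superlatticeZ (dvdn_mull _ _) Zd.
  by move=> /dmin; rewrite leqNgt ltn_pmod.
by move=> dj; exact: superlattice_dvd superlatticeZ dj Zd.
Qed.

End Superlattices.

(** * Representatives of (1/m) Z^k modulo Z^k *)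

Section Residues.
Variables (k : nat).
Local Notation Z := (Zlattice k).

Definition residue_point (m : nat) (t : {ffun 'I_k -> 'I_m}) : 'rV[rat]_k :=
  m%:R^-1 *: map_mx intr (\row_j (t j : nat)%:Z).

Lemma residue_decomposition m (x : 'rV[rat]_k) : (0 < m)%N -> Z (x *+ m) ->
  exists t : {ffun 'I_k -> 'I_m}, Z (x - residue_point t).
Proof.
move=> m0 [z _ zx]; have mQ : m%:R != 0 :> rat by rewrite pnatr_eq0 -lt0n.
have rlt j : (absz (z 0%R j %% m%:Z)%Z < m)%N.
  by rewrite -ltz_nat gez0_abs ?modz_ge0 ?ltz_pmod // lt0r_neq0.
exists [ffun j => Ordinal (rlt j)], (\row_j (z 0%R j %/ m%:Z)%Z) => //.
apply: (scalerI mQ).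
rewrite scalerBr [X in _ = _ - X]scalerA divff // scale1r [in RHS]scaler_nat -zx.
apply/rowP => j; rewrite !mxE ffunE /= {2}(divz_eq (z 0 j) m%:Z).
rewrite intrD intrM gez0_abs ?modz_ge0 ?lt0r_neq0 // ?ltz_nat //.
by rewrite addrK mulrC.
Qed.

(** The group mL is generated by m Z^k and finitely many residues, the rows of [A]. The Smith normal
    form of [A] replaces these rows by [k] generators, which are independent because L contains the
    unit vectors. *)
Lemma superlattice_is_lattice (L : set 'rV[rat]_k) (m : nat) : superlattice L ->
  (0 < m)%N -> (forall x, L x -> Z (x *+ m)) -> is_lattice L.
Proof.
move=> sL m0 mL; have mQ : m%:R != 0 :> rat by rewrite pnatr_eq0 -lt0n.
pose T := [set t : {ffun 'I_k -> 'I_m} | `[< L (residue_point t) >]]%SET.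
pose C := \matrix_(i < #|T|, j < k) (enum_val i j : nat)%:Z.
pose A : 'M[int]_(k + #|T|, k) := col_mx m%:Z%:M C.
have Crow i : m%:R^-1 *: map_mx intr (row i C) = residue_point (enum_val i).
  by congr (_ *: map_mx _ _); apply/rowP => j; rewrite !mxE.
have LA x : L x <-> exists c : 'rV[int]_(k + #|T|), x *+ m = map_mx intr (c *m A).
  split=> [Lx|[c xc]].
    have [t Zt] := residue_decomposition m0 (mL x Lx).
    have tT : t \in T.
      rewrite inE; apply/asboolP; rewrite -[residue_point t](subKr x).
      by apply: sL.2 => //; exact: sL.1.
    have [z _ zE] := Zt; exists (row_mx z (delta_mx 0 (enum_rank_in tT t))).
    rewrite mul_row_col -rowE mul_mx_scalar map_mxD map_mxZ zE.
    rewrite -[x in LHS](subrK (residue_point t)) mulrnDl; congr (_ + _).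
      by rewrite scaler_int.
    rewrite -{1}(enum_rankK_in tT tT) -Crow -scaler_nat scalerA divff //.
    by rewrite scale1r.
  have -> : x = m%:R^-1 *: map_mx intr (c *m A).
    by rewrite -xc -scaler_nat scalerA mulVf // scale1r.
  rewrite -[c]hsubmxK mul_row_col mul_mx_scalar map_mxD map_mxZ scalerDr.
  rewrite [X in X + _]scalerA /= -pmulrn mulVf // scale1r.
  apply: superlatticeD => //; first by apply: sL.1; exists (lsubmx c).
  rewrite mulmx_sum_row raddf_sum scaler_sumr /=.
  elim/big_rec: _ => [|i y _ Ly]; first exact: superlattice0.
  apply: superlatticeD => //; rewrite map_mxZ scalerA mulrC -scalerA scaler_int.
  apply: superlatticeMz => //; rewrite Crow.
  by have := enum_valP i; rewrite inE => /asboolP.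
have [U uU [V uV [d _ AE]]] := int_Smith_normal_form A.
pose D := diag_mx (\row_(j < k) d`_j).
have DE : \matrix_(i, j) (d`_i *+ (i == j :> nat)) = col_mx D 0 :> 'M_(k + #|T|, k).
  apply/matrixP => i j; rewrite !mxE; case: splitP => l il; rewrite !mxE il.
    by [].
  by rewrite gtn_eqF // ltn_addr.
have {}LA x : L x <-> exists w : 'rV[int]_k, x *+ m = map_mx intr (w *m (D *m V)).
  rewrite LA; split=> [[c ->]|[w ->]].
    exists (lsubmx (c *m U)); rewrite AE DE !mulmxA -{1}[c *m U]hsubmxK.
    by rewrite mul_row_col mulmx0 addr0.
  exists (row_mx w 0 *m invmx U); rewrite AE DE !mulmxA mulmxKV //.
  by rewrite mul_row_col mulmx0 addr0.
pose B : 'M[rat]_k := m%:R^-1 *: map_mx intr (D *m V).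
have uB : B \in unitmx.
  have rW i : exists w : 'rV[int]_k, row i (1%:M : 'M[rat]_k) = map_mx intr w *m B.
    have /LA[w wE] : L (row i 1%:M).
      by apply: sL.1; exists (row i 1%:M) => //; rewrite map_row map_mx1.
    exists w; rewrite -scalemxAr -map_mxM -wE -scaler_nat scalerA mulVf //.
    by rewrite scale1r.
  have [W WE] := choice rW.
  have /mulmx1_unit[] // : (\matrix_i map_mx intr (W i)) *m B = 1%:M.
  by apply/row_matrixP => i; rewrite row_mul rowK -WE.
exists B => //; apply/seteqP; split=> [x /LA[w wE]|_ [w _ <-]].
  exists w => //; rewrite -scalemxAr -map_mxM -wE -scaler_nat scalerA mulVf //.
  by rewrite scale1r.
apply/LA; exists w.
by rewrite -scalemxAr -map_mxM -scaler_nat scalerA divff // scale1r.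
Qed.

End Residues.

(** The equations are triangular for divisibility and are solved from [e = m] downwards; after [j]
    rounds those with [e > m - j] hold. *)
Lemma moebius_inversion (f : nat -> rat) (m : nat) : (0 < m)%N ->
  exists w : nat -> rat,
    forall e, (e %| m)%N -> f e = \sum_(d <- divisors m | (e %| d)%N) w d.
Proof.
move=> m0; suff /(_ m)[w wP] : forall j, exists w : nat -> rat,
    forall e, (e %| m)%N -> (m < e + j)%N ->
    f e = \sum_(d <- divisors m | (e %| d)%N) w d.
  exists w => e em; apply: wP => //.
  by rewrite -[X in (X < _)%N]add0n ltn_add2r (dvdn_gt0 m0).
elim=> [|j [w wP]].
  by exists (fun=> 0) => e /(dvdn_leq m0); rewrite addn0 leqNgt => /negP.
(* Only the value at [e0] is changed. Equations for [e > e0] do not see it, since [e] cannot divide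
   a smaller positive number. *)
pose e0 := (m - j)%N.
exists (fun d => if d == e0 then
    f e0 - \sum_(d <- divisors m | (d != e0) && (e0 %| d)%N) w d else w d).
move=> e em; rewrite addnS ltnS leq_eqVlt => /orP[/eqP mej|mej]; last first.
  have e0e : (e0 < e)%N.
    by have := dvdn_gt0 m0 em; rewrite /e0; lia.
  rewrite (wP e em mej) [LHS]big_seq_cond [RHS]big_seq_cond.
  apply: eq_bigr => d; rewrite -dvdn_divisors // => /andP[dm ed].
  case: eqP => // de0; have := dvdn_leq (dvdn_gt0 m0 dm) ed.
  by rewrite de0 leqNgt e0e.
have -> : e = e0 by rewrite /e0 mej addnK.
rewrite big_mkcond (bigD1_seq e0) //=; last exact: divisors_uniq; last first.
  by rewrite -dvdn_divisors // (_ : e0 = e) // /e0 mej addnK.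
rewrite dvdnn eqxx -big_mkcondr [X in _ + X](eq_bigr w) ?subrK //.
by move=> d /andP[/negPf ->].
Qed.

(** * Counting superlattices through a point *)

Lemma intmx_unit n (g : 'M[int]_n) : g \in unitmx ->
  (map_mx intr g : 'M[rat]_n) \in unitmx.
Proof. by rewrite !unitmxE det_map_mx => gu; exact: rmorph_unit. Qed.

Lemma nat_horner_inj (p q : {poly rat}) :
  (forall t : nat, (0 < t)%N -> p.[t%:R] = q.[t%:R]) -> p = q.
Proof.
move=> pq; apply/eqP; rewrite -subr_eq0; apply/negPn/negP => pq0.
pose rs : seq rat := [seq i%:R | i <- iota 1 (size (p - q))].
have : (size rs < size (p - q)%R)%N.
  apply: max_poly_roots => //.
    apply/allP => x /mapP[i]; rewrite mem_iota => /andP[i1 _] ->.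
    by rewrite /root hornerD hornerN pq // subrr.
  by rewrite map_inj_uniq ?iota_uniq // => i j /eqP; rewrite eqr_nat => /eqP.
by rewrite size_map size_iota ltnn.
Qed.

Section DilateLattice.
Variables (R : realType) (k : nat).

Lemma dilate_torsion_points (P : set 'rV[R]_k) (d t : nat) : (0 < d)%N ->
  dilate_points P (torsion_part setT d) t =
    [set d%:R^-1 *: y | y in dilate_points P (Zlattice k) (d * t)]%classic.
Proof.
move=> d0; have dQ : d%:R != 0 :> rat by rewrite pnatr_eq0 -lt0n.
have dR : d%:R != 0 :> R by rewrite pnatr_eq0 -lt0n.
apply/seteqP; split=> [x [[_ Zx] [p Pp px]]|_ [y [Zy [p Pp py]] <-]].
  exists (d%:R *: x); last by rewrite scalerA mulVf // scale1r.
  split; first by rewrite scaler_nat.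
  exists p => //; rewrite map_mxZ -px /= ratr_nat natrM scalerA //.
split.
  by split=> //; rewrite -scaler_nat scalerA divff // scale1r.
exists p => //; rewrite map_mxZ -py fmorphV /= ratr_nat natrM.
by rewrite scalerA mulrA mulVf // mul1r.
Qed.

End DilateLattice.

(** * Families of superlattices with a transitive symmetry and coprime splitting *)

Section SuperlatticeFamily.
Variables (k : nat) (i0 : 'I_k) (S : nat -> set (set 'rV[rat]_k)).
Local Notation Z := (Zlattice k).

Hypothesis S_lattice : forall m L, (0 < m)%N -> S m L ->
  [/\ is_lattice L, (Z `<=` L)%classic & forall x, L x -> Z (x *+ m)].

Hypothesis S_symmetric : forall z : 'rV[int]_k,
  exists (g : 'M[int]_k) (c : int),
  [/\ g \in unitmx, z *m g = c *: delta_mx 0 i0 & forall m L, (0 < m)%N -> S m L <->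
    S m [set x *m map_mx intr g | x in L]%classic].

Hypothesis S_coprime : forall a b L, (0 < a)%N -> (0 < b)%N -> coprime a b ->
  superlattice L -> (forall x, L x -> Z (x *+ (a * b))) ->
  S (a * b)%N L <-> S a (torsion_part L a) /\ S b (torsion_part L b).

Lemma S_superlattice m L : (0 < m)%N -> S m L -> superlattice L.
Proof. by move=> m0 /(S_lattice m0)[lL ZL _]; exact: lattice_superlattice. Qed.

(** A member is a union of cosets of Z^k inside (1/m) Z^k, hence determined by a subset of the
    finitely many residues. *)
Lemma finite_S m : (0 < m)%N -> finite_set (S m).
Proof.
move=> m0; pose G (T : {set {ffun 'I_k -> 'I_m}}) : set 'rV[rat]_k :=
  [set x | exists2 t, t \in T & Z (x - residue_point t)]%classic.
apply: (@sub_finite_set _ _ (range G)); last exact/finite_image/finite_finset.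
move=> L SL; have sL := S_superlattice m0 SL; have [_ ZL mL] := S_lattice m0 SL.
exists [set t | `[< L (residue_point t) >]]%SET => //; apply/seteqP; split=> x.
  move=> [t]; rewrite inE => /asboolP Lt /ZL Lx.
  by rewrite -(subrK (residue_point t) x); exact: superlatticeD.
move=> Lx; have [t Zt] := residue_decomposition m0 (mL x Lx).
exists t => //; rewrite inE; apply/asboolP.
by rewrite -[residue_point t](subKr x); apply: sL.2 => //; exact: ZL.
Qed.

Definition count_at (s : seq (set 'rV[rat]_k)) (x : 'rV[rat]_k) : rat :=
  \sum_(L <- s) (`[< L x >] : nat)%:R.

Definition enumerates m (s : seq (set 'rV[rat]_k)) :=
  uniq s /\ forall L, L \in s <-> S m L.

Lemma S_enum m : (0 < m)%N -> exists s, enumerates m s.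
Proof.
move=> /finite_S/finite_seqP[s sE]; exists (undup s); split; first exact: undup_uniq.
by move=> L; rewrite mem_undup sE.
Qed.

(** The action of [g] permutes the members of [S m]. *)
Lemma count_at_transl m s (g : 'M[int]_k) x : (0 < m)%N -> enumerates m s ->
  g \in unitmx -> (forall L, S m L <-> S m [set x *m map_mx intr g | x in L]%classic) ->
  count_at s (x *m map_mx intr g) = count_at s x.
Proof.
move=> m0 [us sP] ug Sg; set gQ : 'M[rat]_k := map_mx intr g.
have ugQ : gQ \in unitmx by exact: intmx_unit.
pose phi (h : 'M[rat]_k) (L : set 'rV[rat]_k) := [set x *m h | x in L]%classic.
have phiK h h' : h *m h' = 1%:M -> cancel (phi h) (phi h').
  move=> hh' L; apply/seteqP; split=> [_ [_ [y Ly <-] <-]|y Ly].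
    by rewrite -mulmxA hh' mulmx1.
  by exists (y *m h); [exists y|rewrite -mulmxA hh' mulmx1].
have gK := phiK _ _ (mulmxV ugQ); have gK' := phiK _ _ (mulVmx ugQ).
have ps : perm_eq s [seq phi gQ L | L <- s].
  apply: uniq_perm => // [|L]; first by rewrite map_inj_uniq //; exact: can_inj gK.
  apply/idP/mapP => [/sP SL|[K /sP/Sg SK ->]]; last exact/sP.
  by exists (phi (invmx gQ) L); rewrite ?gK' //; apply/sP/Sg; rewrite -/(phi gQ _) gK'.
rewrite /count_at (perm_big _ ps) big_map; apply: eq_bigr => L _.
congr (nat_of_bool _)%:R; apply/asboolP/asboolP => [[y Ly /(congr1 (mulmx^~ (invmx gQ)))]|Lx].
  by rewrite !mulmxK // => <-.
by exists x.
Qed.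

(** A pair is a weight [w_d] with its divisor [d]; repeated divisors are allowed, and the identity
    is required for every [x], also outside (1/m) Z^k. *)
Definition represents m (r : seq (rat * nat)) :=
  (forall p, p \in r -> (p.2 %| m)%N) /\
  forall s x, enumerates m s ->
    count_at s x = \sum_(p <- r) p.1 * (`[< Z (x *+ p.2) >] : nat)%:R.

(** With [x = z / d], a symmetry sends [x] to [c e / d], where [e] is the fixed basis vector. Since
    [x] has order [d], the integer [c] is prime to [d], so [c e / d] and [e / d] generate the same
    group modulo Z^k and lie in the same superlattices. *)
Lemma count_at_order m s x d : (0 < m)%N -> enumerates m s ->
  Z (x *+ m) -> (0 < d)%N -> (forall j : nat, Z (x *+ j) <-> (d %| j)%N) ->
  count_at s x = count_at s (d%:R^-1 *: delta_mx 0 i0).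
Proof.
move=> m0 sE Zm d0 dP; have dQ : d%:R != 0 :> rat by rewrite pnatr_eq0 -lt0n.
have [z _ zx] := (dP d).2 (dvdnn d).
have [g [c [ug zg Sg]]] := S_symmetric z.
have xE : x = d%:R^-1 *: map_mx intr z by rewrite zx -scaler_nat scalerA mulVf ?scale1r.
set e : 'rV[rat]_k := delta_mx 0 i0.
have ee : map_mx intr (delta_mx 0 i0 : 'rV[int]_k) = e by rewrite map_delta_mx.
have Ze : Z e by exists (delta_mx 0 i0).
have zge : map_mx intr z *m map_mx intr g = e *~ c.
  by rewrite -map_mxM zg map_mxZ ee scaler_int.
have xg : x *m map_mx intr g = (d%:R^-1 *: e) *~ c.
  by rewrite xE -scalemxAl zge scalerMzr.
have ugQ := intmx_unit ug.
(* If [G] is the gcd, then [d / G] already annihilates [x] modulo Z^k, which forces [G = 1]. *)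
have gd : coprimez c d%:Z.
  pose G := gcdn (absz c) d.
  have [q cq] : exists q, c = q * G%:Z by apply/dvdzP; rewrite dvdzE; exact: dvdn_gcdl.
  have [r dr] := dvdnP (dvdn_gcdr (absz c) d); rewrite -/G in dr.
  have [r0 G0] : (0 < r)%N /\ (0 < G)%N.
    by apply/andP; rewrite -muln_gt0 -dr.
  have /(dvdn_leq r0) : (d %| r)%N.
    apply/dP; exists (q *: delta_mx 0 i0 *m invmx g) => //.
    apply: (can_inj (mulmxK ugQ)); rewrite -map_mxM mulmxKV // map_mxZ ee.
    rewrite -scaler_nat -scalemxAl xg -scaler_int !scalerA cq intrM dr natrM.
    congr (_ *: _); rewrite -pmulrn; field.
    by rewrite !pnatr_eq0 -!lt0n r0 G0.
  rewrite {1}dr -[X in (_ <= X)%N]muln1 leq_pmul2l // => G1.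
  by apply/eqP; congr Posz; apply/eqP; rewrite eqn_leq G1.
have [u [v uv]] : exists u v : int, u * c + v * d%:Z = 1.
  by have /coprimezP[[u v] /= uv] := gd; exists u, v.
rewrite -(count_at_transl x m0 sE ug (fun L => Sg m L m0)).
apply: eq_big_seq => L Ls; have SL := (sE.2 L).1 Ls.
have sL := S_superlattice m0 SL; congr (nat_of_bool _)%:R.
rewrite xg.
apply/asboolP/asboolP => [Lc|Le]; last exact: superlatticeMz.
have -> : d%:R^-1 *: e = (d%:R^-1 *: e) *~ c *~ u + e *~ v.
  rewrite -mulrzA mulrC.
  have -> : e *~ v = (d%:R^-1 *: e) *~ (v * d%:Z).
    by rewrite mulrC mulrzA -pmulrn -scaler_nat scalerA divff // scale1r.
  by rewrite -mulrzDr uv.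
by apply: superlatticeD => //; apply: superlatticeMz => //; exact: sL.1.
Qed.

Lemma represents_exists m : (0 < m)%N -> exists r, represents m r.
Proof.
move=> m0; have [s sE] := S_enum m0.
have [w wP] := moebius_inversion (fun d => count_at s (d%:R^-1 *: delta_mx 0 i0)) m0.
exists [seq (w d, d) | d <- divisors m]; split.
  by move=> p /mapP[d]; rewrite -dvdn_divisors // => dm ->.
move=> s' x s'E; have -> : count_at s' x = count_at s x.
  apply: perm_big; apply: uniq_perm; [exact: s'E.1|exact: sE.1|].
  by move=> L; apply/idP/idP => [/s'E.2/sE.2|/sE.2/s'E.2].
(* Outside (1/m) Z^k both sides vanish: no member contains [x], and no divisor of [m] annihilates
   it. *)
rewrite big_map /=; have [Zm|nZm] := pselect (Z (x *+ m)); last first.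
  rewrite big1_seq; last first.
    move=> d; rewrite -dvdn_divisors // => dm; case: asboolP => [Zd|_]; last by rewrite mulr0.
    by case: nZm; exact: superlattice_dvd (superlatticeZ _) dm Zd.
  rewrite /count_at big1_seq // => L /sE.2/(S_lattice m0)[_ _ mL].
  by case: asboolP => // /mL.
have [d d0 dP] := exists_order m0 Zm.
rewrite (count_at_order m0 sE Zm d0 dP) wP; last exact/dP.
rewrite big_mkcond; apply: eq_bigr => j _.
have -> : `[< Z (x *+ j) >] = (d %| j)%N by apply/asboolP/idP => /dP.
by case: (d %| j)%N; rewrite ?mulr1 ?mulr0.
Qed.

(** Members of [S (a * b)] are the sums of members of [S a] and [S b], so the count at [x] is the
    product of the counts at its two components. Likewise [p.2 * q.2] annihilates [x] modulo Z^k
    exactly when [p.2] and [q.2] annihilate the respective components. *)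
Lemma represents_coprime a b ra rb : (0 < a)%N -> (0 < b)%N -> coprime a b ->
  represents a ra -> represents b rb ->
  represents (a * b) [seq (p.1 * q.1, (p.2 * q.2)%N) | p <- ra, q <- rb].
Proof.
move=> a0 b0 ab [da ra_P] [db rb_P]; have ab0 : (0 < a * b)%N by rewrite muln_gt0 a0.
have [u [v uv]] : exists u v : int, u * a%:Z + v * b%:Z = 1.
  have /coprimezP[[u v] /= uv] : coprimez a%:Z b%:Z by [].
  by exists u, v.
have vu : v * b%:Z + u * a%:Z = 1 by rewrite addrC.
have [sa saE] := S_enum a0; have [sb sbE] := S_enum b0.
split=> [_ /allpairsP[[p q] [/da pa /db qb ->]]|s x [us sP]]; first exact: dvdn_mul.
have ps : perm_eq s [seq join_lattice K1 K2 | K1 <- sa, K2 <- sb].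
  have torL K1 K2 : K1 \in sa -> K2 \in sb ->
      torsion_part (join_lattice K1 K2) a = K1 /\ torsion_part (join_lattice K1 K2) b = K2.
    move=> /saE.2 S1 /sbE.2 S2.
    have [_ _ t1] := S_lattice a0 S1; have [_ _ t2] := S_lattice b0 S2.
    have l1 := S_superlattice a0 S1; have l2 := S_superlattice b0 S2.
    split; first exact: (torsion_join uv l1 l2 t1 t2).
    by rewrite join_latticeC; exact: (torsion_join vu l2 l1 t2 t1).
  apply: uniq_perm => // [|L].
    apply: allpairs_uniq; [exact: saE.1|exact: sbE.1|].
    move=> _ _ /allpairsP[[K1 K2] [/= h1 h2 ->]] /allpairsP[[K1' K2'] [/= h1' h2' ->]] /= e.
    have [e1 e2] := torL _ _ h1 h2; have [f1 f2] := torL _ _ h1' h2'.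
    by congr pair; [rewrite -e1 e f1|rewrite -e2 e f2].
  apply/idP/allpairsP => [/sP SL|[[K1 K2] [/= h1 h2 ->]]].
    have lL := S_superlattice ab0 SL; have [_ _ tL] := S_lattice ab0 SL.
    have [Sa Sb] := (S_coprime a0 b0 ab lL tL).1 SL.
    exists (torsion_part L a, torsion_part L b); split; [exact/saE.2|exact/sbE.2|].
    by rewrite /= (join_torsion uv).
  have S1 := (saE.2 _).1 h1; have S2 := (sbE.2 _).1 h2.
  have [e1 e2] := torL _ _ h1 h2; apply/sP/S_coprime => //.
  - by apply: superlattice_join; [exact: S_superlattice S1|exact: S_superlattice S2].
  - have [_ _ t1] := S_lattice a0 S1; have [_ _ t2] := S_lattice b0 S2.
    move=> _ [p [q [/t1 Zp /t2 Zq ->]]]; rewrite mulrnDl.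
    apply: superlatticeD (superlatticeZ k) _ _.
      exact: superlattice_dvd (superlatticeZ k) (dvdn_mulr _ _) Zp.
    exact: superlattice_dvd (superlatticeZ k) (dvdn_mull _ _) Zq.
  - by rewrite e1 e2.
rewrite /count_at (perm_big _ ps) big_allpairs_dep /= big_allpairs_dep /=.
transitivity (count_at sa (x *~ (v * b%:Z)) * count_at sb (x *~ (u * a%:Z))).
  rewrite /count_at mulr_suml; apply: eq_big_seq => K1 /saE.2 S1.
  rewrite mulr_sumr; apply: eq_big_seq => K2 /sbE.2 S2.
  have [_ _ t1] := S_lattice a0 S1; have [_ _ t2] := S_lattice b0 S2.
  have l1 := S_superlattice a0 S1; have l2 := S_superlattice b0 S2.
  rewrite -natrM mulnb; congr (nat_of_bool _)%:R.
  by apply/asboolP/andP => [/(join_latticeE uv _ l1 l2 t1 t2)[/asboolP ? /asboolP]|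
    [/asboolP ? /asboolP ?]] //; apply/(join_latticeE uv _ l1 l2 t1 t2).
rewrite ra_P // rb_P // mulr_suml; apply: eq_big_seq => p /da pa.
rewrite mulr_sumr; apply: eq_big_seq => q /db qb /=.
rewrite mulrACA -natrM mulnb; congr (_ * (nat_of_bool _)%:R).
have lZ := superlatticeZ k.
apply/andP/asboolP => [[/asboolP Zp /asboolP Zq]|Zpq].
  have -> : x = x *~ (v * b%:Z) + x *~ (u * a%:Z) by rewrite -mulrzDr vu.
  rewrite mulrnDl {1}mulnC !mulrnA; apply: superlatticeD => //.
    by rewrite -mulrnA mulnC mulrnA; exact: superlatticeMn.
  by rewrite -mulrnA mulnC mulrnA; exact: superlatticeMn.
have [pa' paE] := dvdnP pa; have [qb' qbE] := dvdnP qb.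
split; apply/asboolP.
  have -> : x *~ (v * b%:Z) *+ p.2 = x *+ (p.2 * q.2) *~ (v * qb'%:Z).
    by rewrite !pmulrn -!mulrzA qbE !PoszM; congr (_ *~ _); ring.
  exact: superlatticeMz.
have -> : x *~ (u * a%:Z) *+ q.2 = x *+ (p.2 * q.2) *~ (u * pa'%:Z).
  by rewrite !pmulrn -!mulrzA paE !PoszM; congr (_ *~ _); ring.
exact: superlatticeMz.
Qed.

Lemma is_lattice_Zlattice : is_lattice Z.
Proof.
exists 1%:M; first exact: unitmx1.
by apply/seteqP; split=> _ [z _ <-]; exists z; rewrite ?mulmx1.
Qed.

(** The identity is first proved between polynomials, by evaluation at positive integers [t]: pairs
    of a superlattice and one of its points in tP are counted in both orders. *)
Lemma sum_ehrhart_coef (R : realType) (P : set 'rV[R]_k) (l m : nat) r :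
  lattice_polytope P -> (0 < m)%N -> represents m r ->
  \sum_(L \in S m) ehrhart_coef P L l =
  (\sum_(p <- r) p.1 * p.2%:R ^+ l) * ehrhart_coef P Z l.
Proof.
move=> polP m0 [rm rP]; have [s sE] := S_enum m0; have [us sP] := sE.
have -> : S m = [set` s]%classic by apply/seteqP; split=> L /sP.
rewrite -fsbig_seq //.
have EZ := ehrhart_polyP polP is_lattice_Zlattice (fun x Zx => Zx).
set E := ehrhart_poly P Z in EZ.
(* This is E(dX), the polynomial of P for (1/d) Z^k; its coefficients are the source of the factors
   [d ^ l]. *)
pose dil (d : nat) := \poly_(i < size E) (E`_i * d%:R ^+ i).
have dilE d x : (dil d).[x] = E.[d%:R * x].
  rewrite horner_poly horner_coef; apply: eq_bigr => i _.
  by rewrite exprMn mulrA.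
have sum_poly : \sum_(L <- s) ehrhart_poly P L = \sum_(p <- r) p.1 *: dil p.2.
  apply: nat_horner_inj => t t0; rewrite !horner_sum.
  have seqE d : (0 < d)%N -> exists X : seq 'rV[rat]_k, [/\ uniq X,
      forall x, x \in X <-> dilate_points P (torsion_part setT d) t x &
      E.[(d * t)%:R] = (size X)%:R].
    move=> d0; have dQ : d%:R != 0 :> rat by rewrite pnatr_eq0 -lt0n.
    have dt0 : (0 < d * t)%N by rewrite muln_gt0 d0.
    have [c /card_eq_seq[X [uX XP sX]] Ec] := EZ _ dt0.
    exists [seq d%:R^-1 *: y | y <- X]; split; last by rewrite size_map Ec sX.
      by rewrite map_inj_uniq //; apply: scalerI; rewrite invr_eq0.
    move=> x; rewrite dilate_torsion_points //; split.
      by move=> /mapP[y /XP Py ->]; exists y.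
    by move=> [y /XP Py <-]; exact: map_f.
  (* [X] lists the points of tP in (1/m) Z^k, which contains every member of [S m]. *)
  have [X [uX XP _]] := seqE m m0.
  have cnt L : L \in s -> (ehrhart_poly P L).[t%:R] = \sum_(x <- X) (`[< L x >] : nat)%:R.
    move=> /sP SL; have [iL ZL mL] := S_lattice m0 SL.
    have [c /card_eq_seq[Y [uY YP sY]] ->] := ehrhart_polyP polP iL ZL t0.
    rewrite -natr_sum -sY; congr _%:R; rewrite -big_mkcond sum1_count -size_filter.
    apply: perm_size; apply: uniq_perm; rewrite ?filter_uniq // => x.
    rewrite mem_filter; apply/idP/andP => [/YP[Lx Px]|[/asboolP Lx /XP[_ Px]]].
      by split; [exact/asboolP|apply/XP; split=> //; split=> //; exact: mL].
    by apply/YP; split.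
  rewrite (eq_big_seq _ cnt) exchange_big /=.
  transitivity (\sum_(x <- X) \sum_(p <- r) p.1 * (`[< Z (x *+ p.2) >] : nat)%:R).
    by apply: eq_bigr => x _; rewrite -(rP s).
  rewrite exchange_big /=; apply: eq_big_seq => p /rm pm.
  rewrite -mulr_sumr hornerZ dilE; congr (_ * _).
  have [Y [uY YP sY]] := seqE p.2 (dvdn_gt0 m0 pm).
  rewrite -natrM sY -natr_sum; congr _%:R.
  rewrite -big_mkcond sum1_count -size_filter.
  apply: perm_size; apply: uniq_perm; rewrite ?filter_uniq // => x.
  rewrite mem_filter; apply/andP/idP => [[/asboolP Zx /XP[_ Px]]|/YP[[_ Zx] Px]].
    by apply/YP; split.
  split; first exact/asboolP.
  by apply/XP; split=> //; split=> //; exact: superlattice_dvd (superlatticeZ k) pm Zx.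
rewrite /ehrhart_coef -coef_sum sum_poly coef_sum mulr_suml.
apply: eq_bigr => p _; rewrite coefZ coef_poly -mulrA; congr (_ * _).
by case: ltnP => [_|sEl]; rewrite mulrC // nth_default // mul0r.
Qed.

Theorem hecke_multiplicative (R : realType) (P : set 'rV[R]_k) (l a b : nat) :
  lattice_polytope P -> ehrhart_coef P Z l != 0 ->
  (0 < a)%N -> (0 < b)%N -> coprime a b ->
  let C m := (ehrhart_coef P Z l)^-1 * \sum_(L \in S m) ehrhart_coef P L l in
  C (a * b)%N = C a * C b.
Proof.
move=> polP E0 a0 b0 ab C.
have [ra raP] := represents_exists a0; have [rb rbP] := represents_exists b0.
have ab0 : (0 < a * b)%N by rewrite muln_gt0 a0.
rewrite /C (sum_ehrhart_coef l polP ab0 (represents_coprime a0 b0 ab raP rbP)).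
rewrite (sum_ehrhart_coef l polP a0 raP) (sum_ehrhart_coef l polP b0 rbP).
rewrite mulrC mulfK // ![_^-1 * _]mulrC !mulfK // big_allpairs_dep /= mulr_suml.
apply: eq_bigr => p _; rewrite mulr_sumr; apply: eq_bigr => q _.
by rewrite natrM exprMn mulrACA.
Qed.

End SuperlatticeFamily.

(** * The index as the order of a finite group *)

(** By Bezout H is the direct product of its a- and b-torsion subgroups. By Cauchy's theorem the
    order of the first is prime to b and that of the second prime to a, so a product equal to ab can
    only split as a and b. *)
Lemma card_abelian_coprime (gT : finGroupType) (H : {group gT}) (a b : nat) :
  abelian H -> (0 < a)%N -> (0 < b)%N -> coprime a b ->
  (forall x, x \in H -> x ^+ (a * b) = 1)%g ->
  #|H| = (a * b)%N <-> #|'Ldiv_a(H)%g| = a /\ #|'Ldiv_b(H)%g| = b.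
Proof.
move=> abH a0 b0 ab Hab.
have inLdiv c x : (x \in 'Ldiv_c(H)%g) = (x \in H) && (x ^+ c == 1)%g.
  by rewrite !inE.
have copr c d : coprime c d -> coprime #|'Ldiv_c(H)%g| d.
  move=> cd; rewrite /coprime; apply/negPn/negP => g1.
  have Lgt : (0 < #|'Ldiv_c(H)%g|)%N by rewrite (cardD1 1%g) inLdiv group1 expg1n eqxx.
  have p_gt1 : (1 < gcdn #|'Ldiv_c(H)%g| d)%N.
    by rewrite ltn_neqAle eq_sym g1 gcdn_gt0 Lgt.
  set p := pdiv (gcdn #|'Ldiv_c(H)%g| d).
  have pr_p : prime p by exact: pdiv_prime.
  have := pdiv_dvd (gcdn #|'Ldiv_c(H)%g| d); rewrite -/p dvdn_gcd => /andP[pL pd].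
  have [x] := Cauchy (G := Group (group_Ldiv c abH)) pr_p pL.
  rewrite /= inLdiv => /andP[_ /eqP xc] xp.
  have pc : (p %| c)%N by rewrite -xp order_dvdn xc.
  have : (p %| gcdn c d)%N by rewrite dvdn_gcd pc pd.
  by rewrite (eqP cd) Euclid_dvd1.
have cardH : #|H| = (#|'Ldiv_a(H)%g| * #|'Ldiv_b(H)%g|)%N.
  rewrite -(TI_cardMg (G := Group (group_Ldiv a abH)) (H := Group (group_Ldiv b abH))).
    apply: eq_card => x; apply/idP/mulsgP => [|[y z]]; last first.
      by rewrite !inLdiv => /andP[Hy _] /andP[Hz _] ->; exact: groupM.
    move=> Hx; have xab : (x ^+ (a * b) = 1)%g := Hab x Hx.
    case: (@egcdnP a b a0) => u v; rewrite (eqP ab) => uv _.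
    exists (x ^- (v * b))%g (x ^+ (u * a))%g; rewrite ?inLdiv ?groupV ?groupX //=.
    - by rewrite expgVn -expgM -mulnA [(b * a)%N]mulnC mulnC expgM xab expg1n invg1.
    - by rewrite -expgM -mulnA mulnC expgM xab expg1n.
    - by rewrite uv expgD expg1 mulKg.
  apply/trivgP/fintype.subsetP => x; rewrite inE !inLdiv.
  move=> /andP[/andP[_ /eqP xa] /andP[_ /eqP xb]].
  have : (#[x]%g %| gcdn a b)%N by rewrite dvdn_gcd !order_dvdn xa xb eqxx.
  by rewrite (eqP ab) dvdn1 order_eq1 inE.
split=> [Hc|[la lb]]; last by rewrite cardH la lb.
have := cardH; rewrite Hc => abE.
have ca := copr a b ab; have cb : coprime #|'Ldiv_b(H)%g| a by apply: copr; rewrite coprime_sym.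
have la : #|'Ldiv_a(H)%g| = a.
  apply/eqP; rewrite eqn_dvd; apply/andP; split.
    by rewrite -(Gauss_dvdl _ ca) abE dvdn_mulr.
  by rewrite -(@Gauss_dvdl _ _ #|'Ldiv_b(H)%g|) 1?coprime_sym // -abE dvdn_mulr.
by split=> //; apply/eqP; rewrite -(eqn_pmul2l a0) abE la.
Qed.

Lemma common_denominator m n (M : 'M[rat]_(m, n)) :
  exists2 N : nat, (0 < N)%N & exists M' : 'M[int]_(m, n), M *+ N = map_mx intr M'.
Proof.
pose N := (\prod_(p : 'I_m * 'I_n) absz (denq (M p.1 p.2)))%N.
have N0 : (0 < N)%N by rewrite prodn_gt0 // => p; rewrite absz_gt0 denq_eq0.
exists N => //; have ent i j : exists z : int, M i j *+ N = z%:~R.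
  have /dvdnP[q NE] : (absz (denq (M i j)) %| N)%N.
    by rewrite /N (bigD1 (i, j)) //= dvdn_mulr.
  exists (numq (M i j) * q%:Z); rewrite NE -mulr_natr natrM natr_absz.
  by rewrite gtr0_norm ?denq_gt0 // intrM numqE -pmulrn mulrCA mulrC.
have [f fE] := choice (fun p : 'I_m * 'I_n => ent p.1 p.2).
by exists (\matrix_(i, j) f (i, j)); apply/matrixP => i j; rewrite mulmxnE !mxE -fE.
Qed.

Section IndexCard.
Variables (k n : nat).
Local Notation Z := (Zlattice k).
Local Notation T := 'rV['I_n.+2]_k.

(** Ordinals below [n.+2] add modulo [n.+2], so modulo Z^k this identifies the finite group [T] with
    (1/(n+2)) Z^k / Z^k. *)
Definition frac_point (t : T) : 'rV[rat]_k := residue_point [ffun j => t 0 j].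

Lemma frac_pointE t j : frac_point t 0 j = (t 0 j : nat)%:R / n.+2%:R.
Proof. by rewrite !mxE ffunE mulrC -pmulrn. Qed.

Lemma frac_point0 : frac_point 0 = 0.
Proof. by apply/rowP => j; rewrite frac_pointE !mxE mul0r. Qed.

Lemma frac_pointD t t' : Z (frac_point (t + t') - (frac_point t + frac_point t')).
Proof.
(* The carries of the addition modulo [n.+2]. *)
pose q j := (((t 0%R j : nat) + (t' 0%R j : nat)) %/ n.+2)%N.
exists (\row_j - (q j)%:Z) => //; apply/rowP => j.
rewrite [RHS]mxE [X in _ + X]mxE [X in _ - X]mxE !frac_pointE !mxE.
have -> : ((t 0 j + t' 0 j)%R : nat) = ((t 0%R j + t' 0%R j) %% n.+2)%N by [].
have := congr1 (fun i : nat => i%:R : rat) (divn_eq (t 0%R j + t' 0%R j) n.+2).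
rewrite -/(q j) !natrD natrM mulrNz -pmulrn -mulrDl => ->.
rewrite [X in _ - X]mulrDl mulfK ?pnatr_eq0 // opprD addrCA subrr addr0 //.
Qed.

Lemma frac_point_inj t t' : Z (frac_point t - frac_point t') -> t = t'.
Proof.
move=> [z _ zE]; apply/rowP => j; apply: val_inj => /=.
have /rowP/(_ j) := zE; rewrite [LHS]mxE [RHS]mxE [X in _ + X]mxE !frac_pointE.
rewrite -mulrBl => /(congr1 ( *%R^~ n.+2%:R)); rewrite divfK ?pnatr_eq0 //.
rewrite !pmulrn -intrM -intrB => /eqP; rewrite eqr_int => /eqP.
have := ltn_ord (t 0 j); have := ltn_ord (t' 0 j).
move: (nat_of_ord (t 0 j)) (nat_of_ord (t' 0 j)) (z 0 j) => x y w yn xn xy.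
have [w1|w1|w0] := ltrgtP w 0; last by lia.
  have : w * n.+2%:Z <= - n.+2%:Z by rewrite -[X in _ <= X]mulN1r ler_pM2r //; lia.
  lia.
have : n.+2%:Z <= w * n.+2%:Z by rewrite -[X in X <= _]mul1r ler_pM2r //; lia.
lia.
Qed.

Lemma frac_pointMn t a : Z (frac_point (t *+ a) - frac_point t *+ a).
Proof.
elim: a => [|a IHa]; first by
  rewrite !mulr0n frac_point0 subr0; exact: superlattice0 (superlatticeZ k).
rewrite !mulrS.
have -> : frac_point (t + t *+ a) - (frac_point t + frac_point t *+ a) =
  (frac_point (t + t *+ a) - (frac_point t + frac_point (t *+ a))) +
  (frac_point (t *+ a) - frac_point t *+ a) by rewrite !opprD !addrA subrK.
exact: superlatticeD (superlatticeZ k) (frac_pointD _ _) IHa.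
Qed.

Lemma frac_point_order t a : t *+ a = 0 <-> Z (frac_point t *+ a).
Proof.
have sZ := superlatticeZ k; have Zt := frac_pointMn t a; split=> [ta|Zta].
  rewrite -[_ *+ a]opprK; apply: superlatticeN => //.
  by move: Zt; rewrite ta frac_point0 sub0r.
apply: frac_point_inj; rewrite frac_point0 subr0.
by rewrite -[frac_point _](subrK (frac_point t *+ a)); exact: superlatticeD.
Qed.

(** A copy of L / Z^k inside [T], as soon as [n.+2] annihilates L modulo Z^k. *)
Definition residues (L : set 'rV[rat]_k) : {set T} := [set t | `[< L (frac_point t) >]].

Lemma group_set_residues L : superlattice L -> group_set (residues L).
Proof.
move=> sL; apply/group_setP; split.
  by rewrite inE; apply/asboolP; rewrite frac_point0; exact: superlattice0.
move=> t t'; rewrite !inE => /asboolP Lt /asboolP Lt'; apply/asboolP.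
rewrite -[frac_point _](subrK (frac_point t + frac_point t')).
by apply: superlatticeD => //; [exact/sL.1/frac_pointD|exact: superlatticeD].
Qed.

Lemma residues_torsion L a : residues (torsion_part L a) = 'Ldiv_a(residues L)%g.
Proof.
apply/setP => t; rewrite !inE FinRing.zmodXgE; apply/asboolP/andP => [[Lt Zt]|].
  by split; [exact/asboolP|apply/eqP/frac_point_order].
by move=> [/asboolP Lt /eqP/frac_point_order].
Qed.

(** Makes the index a group order, to which the theorems of Lagrange and Cauchy apply. *)
Lemma has_index_residues L m : superlattice L -> (forall x, L x -> Z (x *+ n.+2)) ->
  has_index L m <-> #|residues L| = m.
Proof.
move=> sL NL; have sZ := superlatticeZ k.
pose coset x := [set x + z | z in Z]%classic.
have coset_eq x y : Z (x - y) -> coset x = coset y.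
  have sub x' y' : Z (x' - y') -> (coset x' `<=` coset y')%classic.
    move=> Zxy _ [z Zz <-]; exists (x' - y' + z); first exact: superlatticeD.
    by rewrite addrA addrCA subrr addr0.
  move=> Zxy; apply/seteqP; split; apply: sub => //.
  by rewrite -opprB; exact: superlatticeN.
have coset_inj x y : coset x = coset y -> Z (x - y).
  move=> xy; have : coset x x by exists 0; rewrite ?addr0 //; exact: superlattice0.
  by rewrite xy => -[z Zz <-]; rewrite addrC addKr.
have -> : has_index L m =
    ([set coset (frac_point t) | t in [set` residues L]]%classic #= `I_m)%card.
  rewrite /has_index; congr (_ #= _)%card; apply/seteqP; split=> [_ [x Lx <-]|_ [t /= tL <-]].
    have [t Zt] := residue_decomposition (ltn0Sn _) (NL x Lx).
    have tE : frac_point (\row_j t j) = residue_point t.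
      by congr residue_point; apply/ffunP => j; rewrite ffunE mxE.
    exists (\row_j t j); last by rewrite tE; apply/esym/coset_eq.
    rewrite /= inE; apply/asboolP; rewrite tE -[residue_point t](subKr x).
    by apply: sL.2 => //; exact: sL.1.
  by exists (frac_point t) => //; move: tL; rewrite inE => /asboolP.
have injc : {in [set` residues L]%classic &, injective (fun t => coset (frac_point t))}.
  by move=> t t' _ _ /coset_inj/frac_point_inj.
have c1 := inj_card_eq injc.
have c2 : ([set` residues L]%classic #= `I_(#|residues L|))%card.
  by apply/card_eq_seq; exists (enum (residues L)); rewrite enum_uniq -cardE;
     split=> // t; rewrite mem_enum.
split=> [cm|<-]; last exact: card_eq_trans c1 c2.
apply/card_eq_II; apply: card_eq_trans (card_esym c2) _.
exact: card_eq_trans (card_esym c1) cm.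
Qed.

End IndexCard.

(** * Superlattices of given index *)

Section UnimodularAction.
Variables (k : nat) (g : 'M[int]_k).
Hypothesis g_unit : g \in unitmx.
Implicit Types (L : set 'rV[rat]_k) (x : 'rV[rat]_k).
Local Notation Z := (Zlattice k).
Local Notation gQ := (map_mx intr g : 'M[rat]_k).
Local Notation act L := [set x *m gQ | x in L]%classic.

Lemma Zlattice_act x : Z (x *m gQ) <-> Z x.
Proof.
split=> [[z _ zE]|[z _ <-]]; last by exists (z *m g); rewrite ?map_mxM.
exists (z *m invmx g) => //; apply: (can_inj (mulmxK (intmx_unit g_unit))).
by rewrite -map_mxM mulmxKV.
Qed.

Lemma act_mem L x : act L (x *m gQ) <-> L x.
Proof.
split=> [[y Ly /(congr1 (mulmx^~ (invmx gQ)))]|Lx]; last by exists x.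
by rewrite !mulmxK ?intmx_unit // => <-.
Qed.

Lemma is_lattice_act L : is_lattice L <-> is_lattice (act L).
Proof.
split=> -[B uB LB].
  exists (B *m gQ); first by rewrite unitmx_mul uB intmx_unit.
  rewrite LB; apply/seteqP; split=> [_ [_ [z _ <-] <-]|_ [z _ <-]].
    by exists z => //; rewrite mulmxA.
  by exists (map_mx intr z *m B); [exists z|rewrite mulmxA].
exists (B *m invmx gQ); first by rewrite unitmx_mul uB unitmx_inv intmx_unit.
apply/seteqP; split=> [x /act_mem|_ [z _ <-]].
  rewrite LB => -[z _ zE]; exists z => //.
  by rewrite mulmxA zE mulmxK ?intmx_unit.
apply/act_mem; rewrite LB mulmxA mulmxKV ?intmx_unit //.
by exists z.
Qed.

Lemma sub_Zlattice_act L : (Z `<=` L)%classic <-> (Z `<=` act L)%classic.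
Proof.
split=> ZL x Zx; last by apply/act_mem/ZL/Zlattice_act.
rewrite -[x](mulmxKV (intmx_unit g_unit)); apply/act_mem/ZL/Zlattice_act.
by rewrite mulmxKV ?intmx_unit.
Qed.

Lemma has_index_act L m : has_index L m <-> has_index (act L) m.
Proof.
pose coset x := [set x + z | z in Z]%classic.
have cosetg x : act (coset x) = coset (x *m gQ).
  apply/seteqP; split=> [_ [_ [z Zz <-] <-]|_ [z Zz <-]].
    by exists (z *m gQ); [exact/Zlattice_act|rewrite mulmxDl].
  exists (x + z *m invmx gQ); last by rewrite mulmxDl mulmxKV ?intmx_unit.
  by exists (z *m invmx gQ) => //; apply/Zlattice_act; rewrite mulmxKV ?intmx_unit.
have actI (K K' : set 'rV[rat]_k) : act K = act K' -> K = K'.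
  by move=> KK'; apply/seteqP; split=> x /act_mem; [rewrite KK'|rewrite -KK'];
     move/act_mem.
have cE : [set act C | C in [set coset x | x in L]]%classic = [set coset x | x in act L]%classic.
  apply/seteqP; split=> [_ [_ [x Lx <-] <-]|_ [_ [x Lx <-] <-]].
    by exists (x *m gQ); [exists x|].
  by exists (coset x); [exists x|].
have c1 : ([set act C | C in [set coset x | x in L]]%classic #=
  [set coset x | x in L]%classic)%card.
  by apply: inj_card_eq => ? ? _ _; exact: actI.
rewrite cE in c1.
split=> cm; first exact: card_eq_trans c1 cm.
exact: card_eq_trans (card_esym c1) cm.
Qed.

Lemma superlattices_act L m : superlattices k m L <-> superlattices k m (act L).
Proof.
split=> -[iL ZL hL]; split.
- exact: (is_lattice_act L).1.
- exact: (sub_Zlattice_act L).1.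
- exact: (has_index_act L m).1.
- exact: (is_lattice_act L).2.
- exact: (sub_Zlattice_act L).2.
- exact: (has_index_act L m).2.
Qed.

End UnimodularAction.

(** Smith normal form of [z] as a matrix with one row; the left factor is 1 by 1 and goes into
    [c]. *)
Lemma unimodular_transitive k (z : 'rV[int]_k.+1) :
  exists (g : 'M[int]_k.+1) (c : int), g \in unitmx /\ z *m g = c *: delta_mx 0 ord0.
Proof.
have [U uU [V uV [d _ zE]]] := int_Smith_normal_form z.
exists (invmx V), (U 0 0 * d`_0); split; first by rewrite unitmx_inv.
rewrite zE mulmxK //; apply/rowP => j; rewrite !mxE big_ord1 !mxE eqxx /=.
have [->|j0] := eqVneq j ord0; first by rewrite mulr1; congr (U 0 _ * _).
by rewrite eq_sym (negPf (j0 : (j : nat) != 0%N)) !mulr0.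
Qed.

(** Doubling a common denominator gives one of the form [n.+2], as the group of residues
    requires. *)
Lemma superlattice_double k (L : set 'rV[rat]_k) N : superlattice L -> (0 < N)%N ->
  (forall x, L x -> Zlattice k (x *+ N)) ->
  exists n, forall x, L x -> Zlattice k (x *+ n.+2).
Proof.
move=> sL N0 NL; exists (2 * N - 2)%N => x Lx.
have -> : (2 * N - 2).+2 = (2 * N)%N by lia.
exact: superlattice_dvd (superlatticeZ k) (dvdn_mull _ _) (NL x Lx).
Qed.

Lemma lattice_denominator k (L : set 'rV[rat]_k) : is_lattice L ->
  exists2 N, (0 < N)%N & forall x, L x -> Zlattice k (x *+ N).
Proof.
move=> [B _ ->]; have [N N0 [M ME]] := common_denominator B.
exists N => // _ [z _ <-]; exists (z *m M) => //.
by rewrite map_mxM -ME -!scaler_nat scalemxAr.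
Qed.

(** Some denominator exists because L has a basis; this embeds L / Z^k in a finite group, where its
    order [m] annihilates every element. *)
Lemma superlattices_torsion k m (L : set 'rV[rat]_k) : superlattices k m L ->
  [/\ is_lattice L, (Zlattice k `<=` L)%classic & forall x, L x -> Zlattice k (x *+ m)].
Proof.
move=> [iL ZL hL]; split=> // x Lx; have sL := lattice_superlattice iL ZL.
have [N N0 NL] := lattice_denominator iL; have [n nL] := superlattice_double sL N0 NL.
have /(has_index_residues m sL nL) cL := hL.
have [r Zr] := residue_decomposition (ltn0Sn _) (nL x Lx).
pose t : 'rV['I_n.+2]_k := \row_j r j.
have tE : frac_point t = residue_point r.
  by congr residue_point; apply/ffunP => j; rewrite ffunE mxE.
have tL : t \in Group (group_set_residues n sL).
  rewrite /= inE; apply/asboolP; rewrite tE -[residue_point r](subKr x).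
  by apply: sL.2 => //; exact: ZL.
have := expg_cardG tL; rewrite cL FinRing.zmodXgE => /frac_point_order Zt.
rewrite -[x](subrK (frac_point t)) mulrnDl tE.
apply: superlatticeD (superlatticeZ k) _ _; last by rewrite -tE.
exact: superlatticeMn (superlatticeZ k) Zr.
Qed.

Lemma superlattices_coprime k a b (L : set 'rV[rat]_k) : (0 < a)%N -> (0 < b)%N ->
  coprime a b -> superlattice L -> (forall x, L x -> Zlattice k (x *+ (a * b))) ->
  superlattices k (a * b) L <->
  superlattices k a (torsion_part L a) /\ superlattices k b (torsion_part L b).
Proof.
move=> a0 b0 ab sL abL; have ab0 : (0 < a * b)%N by rewrite muln_gt0 a0.
have [n nL] := superlattice_double sL ab0 abL.
have sT c : superlattice (torsion_part L c) by exact: superlattice_torsion.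
have iT c : is_lattice (torsion_part L c).
  by apply: superlattice_is_lattice ab0 _ => // x [/abL].
have iL : is_lattice L by exact: superlattice_is_lattice ab0 abL.
have nT c x : torsion_part L c x -> Zlattice k (x *+ n.+2) by move=> [/nL].
have hT c m := has_index_residues m (sT c) (nT c).
have hL := has_index_residues (a * b) sL nL.
have Hab t : t \in Group (group_set_residues n sL) -> (t ^+ (a * b) = 1)%g.
  rewrite /= inE FinRing.zmodXgE => /asboolP Lt.
  by apply/frac_point_order/abL.
have := card_abelian_coprime (FinRing.zmod_abelian _) a0 b0 ab Hab.
rewrite /= -!residues_torsion -hL -!hT => E; split=> [[_ _ /E[ha hb]]|[[_ _ ha] [_ _ hb]]].
  by split; split=> //; exact: (sT _).1.
by split=> //; [exact: sL.1|apply/E].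
Qed.

(** * Symplectic bases over the integers *)

Section SkewForms.
Variables (k : nat) (M : 'M[int]_k.+1).
Hypotheses (M_skew : M^T = - M) (M_unit : M \in unitmx).

Lemma skew_swap p q (X : 'M_(p, k.+1)) (Y : 'M_(q, k.+1)) :
  X *m M *m Y^T = - (Y *m M *m X^T)^T.
Proof. by rewrite !trmx_mul trmxK M_skew mulNmx mulmxN opprK mulmxA. Qed.

Lemma skew_diag (x : 'rV_k.+1) : x *m M *m x^T = 0.
Proof.
apply/matrixP => i j; rewrite !ord1 [RHS]mxE; have /matrixP/(_ 0 0) := skew_swap x x.
by rewrite [RHS]mxE [X in - X]mxE; lia.
Qed.

(** Fewer conditions than unknowns leave a nonzero rational solution. Made integral and divided by
    its content it is primitive, and unimodularity of [M] then provides a partner with pairing 1. *)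
Lemma orthogonal_primitive j (C : 'M[int]_(j, k.+1)) : (j < k.+1)%N ->
  exists w y : 'rV[int]_k.+1, w *m M *m C^T = 0 /\ w *m M *m y^T = 1%:M.
Proof.
move=> jk; pose A : 'M[rat]_(k.+1, j) := map_mx intr (M *m C^T).
have kerA : kermx A != 0.
  rewrite -mxrank_eq0 mxrank_ker subn_eq0 -ltnNge.
  exact: leq_ltn_trans (rank_leq_col _) jk.
have /rowV0Pn[v /submxP[c vE] v0] := kerA.
have [N N0 [w0 w0E]] := common_denominator v.
have w00 : w0 != 0.
  apply: contraNneq v0 => w0_eq; move: w0E; rewrite w0_eq map_mx0 -scaler_nat => /eqP.
  by rewrite scaler_eq0 pnatr_eq0 eqn0Ngt N0.
have w0A : w0 *m (M *m C^T) = 0.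
  apply: (map_intr_inj (R := rat)); rewrite map_mxM -w0E map_mx0 vE.
  by rewrite -scaler_nat -scalemxAl -mulmxA mulmx_ker mulmx0 scaler0.
have [g [c0 [ug gE]]] := unimodular_transitive w0.
have w0g : w0 = c0 *: (delta_mx 0 ord0 *m invmx g) by rewrite scalemxAl -gE mulmxK.
have c00 : c0 != 0 by apply: contraNneq w00 => c0_eq; rewrite w0g c0_eq scale0r.
(* [w] is [w0] divided by its content [c0], and [y] is chosen so that [M *m y^T] is the first column
   of [g]. *)
exists (delta_mx 0 ord0 *m invmx g), (invmx M *m (g *m (delta_mx 0 ord0)^T))^T; split.
  apply/eqP; move: w0A; rewrite w0g -scalemxAl => /eqP.
  by rewrite scalemx_eq0 (negPf c00) mulmxA.
rewrite trmxK !mulmxA mulmxK // mulmxKV // trmx_delta mul_delta_mx.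
by apply/matrixP => i l; rewrite !ord1 !mxE.
Qed.

(** Symplectic Gram-Schmidt: a new primitive [w] orthogonal to the family is paired with a partner
    made orthogonal to it. *)
Lemma hyperbolic_family j : (j + j <= k.+1)%N -> exists E F : 'M[int]_(j, k.+1),
  [/\ E *m M *m E^T = 0, F *m M *m F^T = 0 & E *m M *m F^T = 1%:M].
Proof.
elim: j => [_|j IHj jk].
  by exists 0, 0; split; apply/matrixP => -[].
have [|E [F [EE FF EF]]] := IHj; first by lia.
have jjk : (j + j < k.+1)%N by lia.
have [w [y [wC wy]]] := orthogonal_primitive (col_mx E F) jjk.
move: wC; rewrite tr_col_mx mul_mx_row -row_mx0 => /eq_row_mx[wE wF].
have FE : F *m M *m E^T = - 1%:M by rewrite skew_swap EF trmx1.
(* [y] without its components along [E] and [F]; the signs differ because [F *m M *m E^T = - 1]. The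
   pairing with [w] stays 1 since [w] is orthogonal to both. *)
pose f := y - (y *m M *m F^T) *m E + (y *m M *m E^T) *m F.
have fE : f *m M *m E^T = 0.
  rewrite !mulmxDl !mulNmx.
  rewrite -[_ *m E *m M *m E^T]mulmxA -[_ *m E *m (M *m _)]mulmxA [E *m _]mulmxA EE.
  rewrite -[_ *m F *m M *m E^T]mulmxA -[_ *m F *m (M *m _)]mulmxA [F *m _]mulmxA FE.
  by rewrite mulmx0 subr0 mulmxN mulmx1 subrr.
have fF : f *m M *m F^T = 0.
  rewrite !mulmxDl !mulNmx.
  rewrite -[_ *m E *m M *m F^T]mulmxA -[_ *m E *m (M *m _)]mulmxA [E *m _]mulmxA EF.
  rewrite -[_ *m F *m M *m F^T]mulmxA -[_ *m F *m (M *m _)]mulmxA [F *m _]mulmxA FF.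
  by rewrite mulmx0 addr0 mulmx1 subrr.
have wf : w *m M *m f^T = 1%:M.
  have Ew : E *m M *m w^T = 0 by rewrite skew_swap wE trmx0 oppr0.
  have Fw : F *m M *m w^T = 0 by rewrite skew_swap wF trmx0 oppr0.
  rewrite skew_swap !mulmxDl !mulNmx.
  rewrite -[_ *m E *m M *m w^T]mulmxA -[_ *m E *m (M *m _)]mulmxA [E *m _]mulmxA Ew.
  rewrite -[_ *m F *m M *m w^T]mulmxA -[_ *m F *m (M *m _)]mulmxA [F *m _]mulmxA Fw.
  by rewrite !mulmx0 subr0 addr0 -skew_swap.
exists (col_mx w E), (col_mx f F).
have blk (u u' : 'rV[int]_k.+1) (X X' : 'M[int]_(j, k.+1)) :
  (col_mx u X : 'M_(1 + j, _)) *m M *m (col_mx u' X')^T =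
  block_mx (u *m M *m u'^T) (u *m M *m X'^T) (X *m M *m u'^T) (X *m M *m X'^T).
  by rewrite mul_col_mx tr_col_mx mul_col_row.
split; rewrite blk.
- by rewrite skew_diag wE EE skew_swap wE trmx0 oppr0 block_mx0.
- by rewrite skew_diag fF FF skew_swap fF trmx0 oppr0 block_mx0.
- by rewrite wf wF EF [E *m _ *m _]skew_swap fE trmx0 oppr0 -scalar_mx_block.
Qed.

End SkewForms.

Definition Jint n : 'M[int]_(n + n) := block_mx 0 1%:M (- 1%:M) 0.

Lemma map_Jint n : map_mx intr (Jint n) = Jmx n.
Proof. by rewrite map_block_mx !map_mx0 map_mxN !map_mx1. Qed.

Lemma Jint_unit n : Jint n \in unitmx.
Proof.
have /mulmx1_unit[] // : Jint n *m (- Jint n) = 1%:M.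
rewrite mulmxN /Jint mulmx_block !mul0mx !mulmx0 !mul1mx !mulmx1.
by rewrite !addr0 !add0r opp_block_mx opprK oppr0 -scalar_mx_block.
Qed.

Lemma Jmx_unit n : Jmx n \in unitmx.
Proof. by rewrite -map_Jint; apply: intmx_unit; exact: Jint_unit. Qed.

Lemma Jint_skew n : (Jint n)^T = - Jint n.
Proof.
by rewrite /Jint tr_block_mx opp_block_mx !trmx0 linearN /= trmx1 opprK oppr0.
Qed.

(** A hyperbolic family of full size has the unimodular Gram matrix [Jint], so its matrix is
    invertible over the integers and the family is a basis. *)
Lemma symplectic_basis n (M : 'M[int]_(n.+1 + n.+1)) : M^T = - M -> M \in unitmx ->
  exists2 U : 'M[int]_(n.+1 + n.+1), U \in unitmx & U *m M *m U^T = Jint n.+1.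
Proof.
move=> Msk uM; have [E [F [EE FF EF]]] :=
  @hyperbolic_family (n + n.+1) M Msk uM n.+1 (leqnn _).
have EFM : col_mx E F *m M *m (col_mx E F)^T = Jint n.+1.
  rewrite mul_col_mx tr_col_mx mul_col_row EE FF EF.
  by rewrite [F *m _ *m _](skew_swap Msk) EF trmx1.
exists (col_mx E F) => //.
by have := Jint_unit n.+1; rewrite -EFM !unitmx_mul => /andP[/andP[]].
Qed.

(** The matrix with rows (a, b) and (c, d) lies in SL_2(Z) and sends the row (p, q) to a row with
    second entry 0. It is built from Bezout coefficients and the quotients of p and q by their
    gcd. *)
Lemma sl2_clear (p q : int) : exists a b c d : int,
  a * d - b * c = 1 /\ p * b + q * d = 0.
Proof.
have [g0|g0] := eqVneq (gcdz p q) 0.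
  move/eqP: g0; rewrite gcdz_eq0 => /andP[/eqP -> /eqP ->].
  by exists 1, 0, 0, 1.
have [u [v uv]] := Bezoutz p q.
have [p' pE] := dvdzP (dvdz_gcdl p q); have [q' qE] := dvdzP (dvdz_gcdr p q).
move: g0 uv pE qE; move: (gcdz p q) => G g0 uv pE qE.
exists u, (- q'), v, p'; split; last by rewrite pE qE; ring.
apply: (mulIf g0); rewrite mul1r -[RHS]uv pE qE; ring.
Qed.

(** One matrix of SL_2(Z) in each hyperbolic plane clears the second half of [z]; then the block
    diagonal matrix of [G] and its inverse transpose, with [G] from [unimodular_transitive], moves
    the first half to a multiple of the first unit vector. *)
Lemma symplectic_transitive n (z : 'rV[int]_(n.+1 + n.+1)) :
  exists (g : 'M[int]_(n.+1 + n.+1)) (c : int),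
  [/\ g \in unitmx, z *m g = c *: delta_mx 0 (lshift _ ord0) &
      g *m Jint n.+1 *m g^T = Jint n.+1].
Proof.
pose N := n.+1; pose p := lsubmx z; pose q := rsubmx z.
have clr i := sl2_clear (p 0 i) (q 0 i).
have [a clra] := choice clr; have [b clrb] := choice clra.
have [c clrc] := choice clrb; have [d abcd] := choice clrc.
pose D (f : 'I_N -> int) : 'M[int]_N := diag_mx (\row_i f i).
have DM f f' : D f *m D f' = D (fun i => f i * f' i).
  by rewrite mulmx_diag; congr diag_mx; apply/rowP => i; rewrite !mxE.
have DT f : (D f)^T = D f by exact: tr_diag_mx.
pose g1 : 'M[int]_(N + N) := block_mx (D a) (D b) (D c) (D d).
have g1J : g1 *m Jint N *m g1^T = Jint N.
  rewrite /g1 /Jint tr_block_mx !DT !mulmx_block !mulmx0 !mulmx1 !mulmxN !mulmx1.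
  rewrite !add0r !addr0 !mulNmx !DM.
  have DE f f' : (- D f) + D f' = D (fun i => f' i - f i).
    by apply/matrixP => i j; rewrite !mxE addrC -mulrnBl.
  rewrite !DE; congr block_mx; apply/matrixP => i j; rewrite !mxE; have [ad _] := abcd i.
  - by rewrite [X in X *+ _](_ : _ = 0) ?mul0rn //; ring.
  - by rewrite [X in X *+ _](_ : _ = 1) // -ad; ring.
  - by rewrite [X in X *+ _](_ : _ = - 1) ?mulNrn // -ad; ring.
  - by rewrite [X in X *+ _](_ : _ = 0) ?mul0rn //; ring.
have z1 : z *m g1 = row_mx (p *m D a + q *m D c) 0.
  rewrite -[z]hsubmxK mul_row_block; congr row_mx.
  apply/rowP => i; rewrite !mul_mx_diag !mxE.
  by have [_ pq] := abcd i; rewrite -[RHS]pq !mxE.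
have [G [e [uG GE]]] := unimodular_transitive (p *m D a + q *m D c).
pose g2 : 'M[int]_(N + N) := block_mx G 0 0 (invmx G)^T.
have g2J : g2 *m Jint N *m g2^T = Jint N.
  rewrite /g2 /Jint tr_block_mx !trmx0 trmxK !mulmx_block !mulmx0 !mul0mx !mulmxN !mulmx1.
  rewrite !add0r !addr0 !mul0mx ?oppr0 !mulNmx ?mulmx0 ?add0r ?addr0 ?oppr0 mulmxV //.
  by rewrite -trmx_mul mulmxV // trmx1.
have gJ : (g1 *m g2) *m Jint N *m (g1 *m g2)^T = Jint N.
  by rewrite trmx_mul -[g1 *m g2 *m _]mulmxA !mulmxA -[g1 *m g2 *m _]mulmxA
     -[g1 *m (g2 *m _) *m _]mulmxA g2J g1J.
exists (g1 *m g2), e; split=> //.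
  have := Jint_unit N; rewrite -{1}gJ -mulmxA unitmx_mul => /andP[].
  by move=> /[!unitmx_mul].
rewrite mulmxA z1 mul_row_block !mul0mx !mulmx0 !addr0 GE.
apply/rowP => i; rewrite !mxE; case: splitP => j ij; rewrite !mxE eqxx /=.
  by congr (_ * (_ : bool)%:R); rewrite -!val_eqE /= ij.
by rewrite -val_eqE /= ij mulr0.
Qed.

(** * Duality of superlattices *)

Section Pairing.
Variable n : nat.
Local Notation V := 'rV[rat]_(n + n).
Local Notation Z := (Zlattice (n + n)).
Implicit Types (x y w : V) (L K : set V).

Definition pairing x y : rat := (x *m Jmx n *m y^T) 0 0.

Lemma pairingDl x x' y : pairing (x + x') y = pairing x y + pairing x' y.
Proof. by rewrite /pairing !mulmxDl mxE. Qed.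

Lemma pairingDr x y y' : pairing x (y + y') = pairing x y + pairing x y'.
Proof. by rewrite /pairing linearD mulmxDr mxE. Qed.

Lemma pairingMnl x y m : pairing (x *+ m) y = pairing x y *+ m.
Proof. by rewrite /pairing -!scaler_nat -!scalemxAl mxE mulr_natl. Qed.

Lemma pairingZr c x y : pairing x (c *: y) = c * pairing x y.
Proof. by rewrite /pairing linearZ -scalemxAr mxE. Qed.

Lemma pairingMnr x y m : pairing x (y *+ m) = pairing x y *+ m.
Proof. by rewrite -scaler_nat pairingZr mulr_natl. Qed.

Lemma pairing_int x y : Z x -> Z y -> pairing x y \is a Num.int.
Proof.
move=> [z _ <-] [t _ <-]; rewrite /pairing -map_Jint map_trmx -!map_mxM mxE.
exact: intr_int.
Qed.

Definition dual_lattice L : set V := [set y | forall x, L x -> pairing x y \is a Num.int]%classic.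

Lemma int_rowP x : (forall j, x 0 j \is a Num.int) -> Z x.
Proof.
move=> xint; have /choice[z zE] j : exists m : int, x 0 j = m%:~R by apply/intrP.
by exists (\row_j z j) => //; apply/rowP => j; rewrite !mxE zE.
Qed.

(* [y^T] is recovered from the pairings of [y] with the rows of [J^-1]. *)
Lemma dual_Zlattice y : dual_lattice Z y -> Z y.
Proof.
move=> Zy; apply: int_rowP => j.
have uJ := Jint_unit n; pose x := row j (invmx (Jint n)).
have /Zy : Z (map_mx intr x) by exists x.
rewrite /pairing -map_Jint -map_mxM /x -row_mul mulVmx // map_row map_mx1.
by rewrite -row_mul mul1mx !mxE.
Qed.

Lemma dual_sub L K : (L `<=` K)%classic -> (dual_lattice K `<=` dual_lattice L)%classic.
Proof. by move=> LK y Ky x /LK; exact: Ky. Qed.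

(* If [L] is defined by a similitude [g], then [kappa] is its multiplier up to sign. *)
Definition symplectic_type (kappa : nat) L :=
  forall y, dual_lattice L y <-> exists2 w, L w & y = w *+ kappa.

(** Duality reverses the inclusion of Z^k in L, and Z^k contains its own dual; so kappa L, the dual
    of L, lies in Z^k. *)
Lemma symplectic_type_torsion kappa L x : (Z `<=` L)%classic ->
  symplectic_type kappa L -> L x -> Z (x *+ kappa).
Proof.
move=> ZL Lk Lx; apply/dual_Zlattice/(dual_sub ZL)/Lk.
by exists x.
Qed.

Lemma int_coprime (q : rat) (a b : nat) : coprime a b ->
  q *+ a \is a Num.int -> q *+ b \is a Num.int -> q \is a Num.int.
Proof.
move=> ab qa qb; have /coprimezP[[u v] /= uv] : coprimez a%:Z b%:Z by [].
have -> : q = q *+ a *~ u + q *+ b *~ v.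
  by rewrite !pmulrn -!mulrzA -mulrzDr [_ * u]mulrC [_ * v]mulrC uv.
by apply: rpredD; apply: rpredMz.
Qed.

(** If y is dual to the al-part, then be y is dual to L, since be maps L into that part; dividing be
    y = al be w by be puts y in al L. Conversely, the pairing of x with al w becomes integral after
    multiplication by al and also by be, hence is integral. *)
Lemma symplectic_type_part L (al be : nat) : (0 < al)%N -> (0 < be)%N -> coprime al be ->
  superlattice L -> symplectic_type (al * be) L -> symplectic_type al (torsion_part L al).
Proof.
move=> al0 be0 co sL Lk y; have sT := superlattice_torsion al sL.
have beQ : be%:R != 0 :> rat by rewrite pnatr_eq0 -lt0n.
split=> [Ty|[w [Lw Zw] ->] x [Lx Zx]].
  have Zy : Z y by apply/dual_Zlattice/(dual_sub sT.1).
  have [w Lw wE] : exists2 w, L w & y *+ be = w *+ (al * be).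
    apply/Lk => x Lx; rewrite pairingMnr -pairingMnl; apply: Ty; split.
      exact: superlatticeMn.
    by rewrite -mulrnA mulnC; exact: (symplectic_type_torsion sL.1 Lk Lx).
  have yE : y = w *+ al.
    by apply: (scalerI beQ); rewrite !scaler_nat wE mulrnA.
  by exists w => //; split=> //; rewrite -yE.
rewrite pairingMnr; apply: (int_coprime co).
  by rewrite -pairingMnl -pairingMnr; exact: pairing_int.
rewrite -mulrnA -pairingMnr; apply: (Lk _).2 Lx.
by exists w.
Qed.

(** A vector dual to the sum is both al p and be q, and Bezout makes it al be times v p + u q.
    Conversely, the cross terms are integral because al and be carry L and K into Z^k. *)
Lemma symplectic_type_join L K (al be : nat) : coprime al be ->
  superlattice L -> superlattice K ->
  symplectic_type al L -> symplectic_type be K ->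
  symplectic_type (al * be) (join_lattice L K).
Proof.
move=> co sL sK La Kb y; have sJ := superlattice_join sL sK.
have tL x : L x -> Z (x *+ al) by apply: symplectic_type_torsion La; exact: sL.1.
have tK x : K x -> Z (x *+ be) by apply: symplectic_type_torsion Kb; exact: sK.1.
split=> [Jy|[_ [p [q [Lp Kq ->]]] ->] _ [p' [q' [Lp' Kq' ->]]]].
  have [p Lp yp] : exists2 p, L p & y = p *+ al.
    apply/La => x Lx; apply: Jy; exists x, 0.
    by split=> //; [exact: superlattice0|rewrite addr0].
  have [q Kq yq] : exists2 q, K q & y = q *+ be.
    apply/Kb => x Kx; apply: Jy; exists 0, x.
    by split=> //; [exact: superlattice0|rewrite add0r].
  have /coprimezP[[u v] /= uv] : coprimez al%:Z be%:Z by [].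
  exists (p *~ v + q *~ u).
    by exists (p *~ v), (q *~ u); split=> //; exact: superlatticeMz.
  rewrite mulrnDl; have -> : p *~ v *+ (al * be) = y *~ (v * be%:Z).
    by rewrite yp !pmulrn -!mulrzA PoszM; congr (_ *~ _); ring.
  have -> : q *~ u *+ (al * be) = y *~ (u * al%:Z).
    by rewrite yq !pmulrn -!mulrzA PoszM; congr (_ *~ _); ring.
  by rewrite -mulrzDr addrC uv.
have dL : pairing p' (p *+ al) \is a Num.int by apply: (La _).2 Lp'; exists p.
have dK : pairing q' (q *+ be) \is a Num.int by apply: (Kb _).2 Kq'; exists q.
rewrite mulrnDl pairingDl !pairingDr; do 2![apply: rpredD].
- by rewrite mulrnA pairingMnr; exact: rpredMn.
- rewrite pairingMnr mulnC mulrnA -pairingMnr -pairingMnl.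
  by apply: pairing_int; [exact: tL|exact: tK].
- rewrite pairingMnr mulrnA -pairingMnr -pairingMnl.
  by apply: pairing_int; [exact: tK|exact: tL].
- by rewrite mulnC mulrnA pairingMnr; exact: rpredMn.
Qed.

Section Isometry.
Variable g : 'M[int]_(n + n).
Hypotheses (g_unit : g \in unitmx) (gJ : g *m Jint n *m g^T = Jint n).
Local Notation gQ := (map_mx intr g : 'M[rat]_(n + n)).
Local Notation act L := [set x *m gQ | x in L]%classic.

Lemma pairing_act x y : pairing (x *m gQ) (y *m gQ) = pairing x y.
Proof.
rewrite /pairing -map_Jint -{2}gJ !map_mxM -map_trmx trmx_mul.
by rewrite !mulmxA.
Qed.

Lemma dual_act L y : dual_lattice (act L) (y *m gQ) <-> dual_lattice L y.
Proof.
split=> [Ly x Lx|Ly _ [x Lx <-]]; last by rewrite pairing_act; exact: Ly.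
by rewrite -pairing_act; apply: Ly; exists x.
Qed.

Lemma symplectic_type_act kappa L :
  symplectic_type kappa L <-> symplectic_type kappa (act L).
Proof.
have gK := mulmxKV (intmx_unit g_unit).
have key y : (exists2 w, act L w & y *m gQ = w *+ kappa) <->
             (exists2 w, L w & y = w *+ kappa).
  split=> [[_ [w Lw <-]]|[w Lw ->]].
    rewrite -scaler_nat scalemxAl => /(congr1 (mulmx^~ (invmx gQ))).
    by rewrite !mulmxK ?intmx_unit // => ->; exists w => //; rewrite scaler_nat.
  by exists (w *m gQ); [exists w|rewrite -!scaler_nat scalemxAl].
split=> Lk y; last by rewrite -dual_act Lk key.
by rewrite -[y]gK dual_act Lk key.
Qed.

End Isometry.

End Pairing.

(** * Symplectic superlattices *)

(** Determinants of both sides give only the square of the claim, hence the absolute values, which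
    are all that the index involves. *)
Lemma similitude_det n (g : 'M[int]_(n + n)) (c : int) :
  g^T *m Jint n *m g = c *: Jint n -> absz (\det g) = (absz c ^ n)%N.
Proof.
move=> /(congr1 (fun A => \det A)); rewrite detZ !det_mulmx det_tr mulrAC.
have uJ : \det (Jint n) != 0.
  by have := Jint_unit n; rewrite unitmxE; apply: contraTneq => ->; rewrite unitr0.
move=> /(mulIf uJ) /(congr1 absz); rewrite abszM abszX.
have -> : (absz c ^ (n + n))%N = ((absz c ^ n) ^ 2)%N by rewrite addnn -muln2 expnM.
by move/eqP; rewrite mulnn eqn_exp2r // => /eqP.
Qed.

(** If L is spanned by the rows of [B = (g^-1)^T], then [B] scales the form by the inverse
    multiplier, so the dual of L is the multiplier times L. Conversely, kappa times the Gram matrix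
    of a basis of L is integral, skew and unimodular; a symplectic basis [B'] for it has an integral
    inverse [W] because L contains Z^k, and [W^T] is the required similitude. *)
Lemma symplectic_superlatticesP n m (L : set 'rV[rat]_(n.+1 + n.+1)) : (0 < m)%N ->
  symplectic_superlattices n.+1 m L <->
  [/\ is_lattice L, (Zlattice (n.+1 + n.+1) `<=` L)%classic &
      exists kappa, [/\ (0 < kappa)%N, (kappa ^ n.+1)%N = m & symplectic_type kappa L]].
Proof.
move=> m0; set N := n.+1.
split=> [[g [[ug [kq kq0 gJ]] gm ->]]|[[B uB ->] ZL [kappa [k0 km Lk]]]].
  set gQ : 'M[rat]_(N + N) := map_mx intr g in ug gJ *.
  pose B := (invmx gQ)^T; have uB : B \in unitmx by rewrite unitmx_tr unitmx_inv.
  have gB : gQ^T *m B = 1%:M by rewrite -trmx_mul mulVmx // trmx1.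
  have Bg : B *m gQ^T = 1%:M by rewrite -trmx_mul mulmxV // trmx1.
  (* The multiplier is an entry of the integral matrix [g^T *m Jint N *m g]. *)
  have [c kqE] : exists c : int, kq = c%:~R.
    have /matrixP/(_ (lshift N ord0) (rshift N ord0)) := gJ.
    rewrite [RHS]mxE [X in _ = _ * X]block_mxEur [X in _ = _ * X]mxE eqxx mulr1 => <-.
    exists ((g^T *m Jint N *m g) (lshift N ord0) (rshift N ord0)).
    by rewrite -map_Jint map_trmx -!map_mxM mxE.
  have c0 : c != 0 by apply: contraNneq kq0 => c0; rewrite kqE c0.
  have gJc : g^T *m Jint N *m g = c *: Jint N.
    apply: (map_intr_inj (R := rat)).
    by rewrite !map_mxM -map_trmx map_mxZ map_Jint gJ kqE.
  have BJ : kq *: (B *m Jmx N *m B^T) = Jmx N.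
    rewrite scalemxAl scalemxAr -gJ !mulmxA Bg mul1mx -mulmxA.
    by rewrite /B trmxK mulmxV // mulmx1.
  split.
  - by exists B.
  - move=> _ [z _ <-]; exists (z *m g^T) => //.
    by rewrite map_mxM -map_trmx -mulmxA gB mulmx1.
  exists (absz c); split.
  - by rewrite absz_gt0.
  - by apply/eqP; rewrite -(similitude_det gJc) -eqz_nat -gm abszE.
  have pairB (x y : 'rV[rat]_(N + N)) : pairing (x *m B) (y *m B) = kq^-1 * pairing x y.
    rewrite /pairing -{2}BJ trmx_mul -scalemxAr -scalemxAl [X in _ = _ * X]mxE mulrA mulVf // mul1r.
    by rewrite !mulmxA.
  have sB : superlattice (row_span B).
    by split=> [_ [z _ <-]|_ _ [z _ <-] [t _ <-]];
      [exists (z *m g^T) => //; rewrite map_mxM -map_trmx -mulmxA gB mulmx1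
      |exists (z - t); rewrite ?map_mxB ?mulmxBl].
  have dualB y : dual_lattice (row_span B) y <-> exists2 w, row_span B w & y = c%:~R *: w.
    split=> [By|[_ [w _ <-] ->] _ [z _ <-]].
      have [w _ wE] : Zlattice (N + N) (kq^-1 *: (y *m gQ^T)).
        apply: dual_Zlattice => _ [z _ <-].
        have := By (map_mx intr z *m B) ltac:(by exists z).
        rewrite -{1}[y](mulmx1) -gB mulmxA pairB.
        by rewrite pairingZr.
      exists (map_mx intr w *m B); first by exists w.
      by rewrite wE -kqE -scalemxAl scalerA divff // scale1r -mulmxA gB mulmx1.
    rewrite scalemxAl pairB pairingZr -kqE mulrA mulVf // mul1r.
    by apply: pairing_int; [exists z|exists w].
  (* A negative multiplier is absorbed by replacing [w] with [- w]. *)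
  move=> y; rewrite dualB; split=> -[w Bw ->].
    case: c {c0 gJc kqE dualB} => c; first by exists w; rewrite ?scaler_nat.
    exists (- w); first exact: superlatticeN.
    by rewrite NegzE mulrNz scaleNr scaler_nat mulNrn.
  case: c {c0 gJc kqE dualB} => c; first by exists w; rewrite ?scaler_nat.
  exists (- w); first exact: superlatticeN.
  by rewrite NegzE mulrNz scaleNr scalerN opprK scaler_nat.
have kQ : kappa%:R != 0 :> rat by rewrite pnatr_eq0 -lt0n.
have uJ := Jmx_unit N.
pose MQ := kappa%:R *: (B *m Jmx N *m B^T).
have rowL i : row_span B (row i B) by exists (delta_mx 0 i) => //; rewrite map_delta_mx -rowE.
have pairM i j : MQ i j = pairing (row i B) (row j B *+ kappa).
  rewrite pairingMnr mxE mulr_natl; congr (_ *+ _).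
  rewrite /pairing -row_mul tr_row [LHS]mxE [RHS]mxE.
  by apply: eq_bigr => l _; rewrite !mxE.
have [M ME] : exists M : 'M[int]_(N + N), MQ = map_mx intr M.
  have /choice[f fE] (p : 'I_(N + N) * 'I_(N + N)) : exists z : int, MQ p.1 p.2 = z%:~R.
    apply/intrP; rewrite pairM; apply: (Lk _).2 (rowL _).
    by exists (row p.2 B).
  by exists (\matrix_(i, j) f (i, j)); apply/matrixP => i j;
    rewrite [RHS]mxE [X in _ = X%:~R]mxE -fE.
have Msk : M^T = - M.
  apply: (map_intr_inj (R := rat)); rewrite -map_trmx map_mxN -ME /MQ linearZ /=.
  rewrite !trmx_mul trmxK -scalerN -map_Jint map_trmx Jint_skew map_mxN.
  by rewrite mulNmx mulmxN mulmxA.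
(* The basis dual to the rows of [B] lies in the dual of L, which is kappa L; its coordinates there
   form an integral inverse of [M]. *)
have uM : M \in unitmx.
  have uBJ : B *m Jmx N \in unitmx by rewrite unitmx_mul uB.
  have yint j : exists z : 'rV[int]_(N + N),
      row j (invmx (B *m Jmx N))^T = kappa%:R *: (map_mx intr z *m B).
    have [_ [z _ <-] zE] : exists2 w, row_span B w & row j (invmx (B *m Jmx N))^T = w *+ kappa.
      apply/Lk => _ [z _ <-]; rewrite /pairing tr_row trmxK -[_ *m B *m _]mulmxA.
      by rewrite colE mulmxA mulmxK // -colE !mxE intr_int.
    by exists z; rewrite zE scaler_nat.
  have [Z ZE] := choice yint.
  have ZB : kappa%:R *: (map_mx intr (\matrix_j Z j) *m B) = (invmx (B *m Jmx N))^T.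
    by apply/row_matrixP => j; rewrite ZE linearZ /= row_mul -map_row rowK.
  have MZ : map_mx intr M *m map_mx intr (\matrix_j Z j)^T = 1%:M :> 'M[rat]_(N + N).
    rewrite -ME /MQ -map_trmx -scalemxAl -!mulmxA -trmx_mul !scalemxAr -linearZ /= ZB.
    by rewrite trmxK mulmxA mulmxV.
  have /mulmx1_unit[] // : M *m (\matrix_j Z j)^T = 1%:M.
  by apply: (map_intr_inj (R := rat)); rewrite map_mxM MZ map_mx1.
have [U uU UM] := symplectic_basis Msk uM.
have uUQ := intmx_unit uU.
have [B' B'E] : exists B' : 'M[rat]_(N + N), B' = map_mx intr U *m B by eexists.
have uB' : B' \in unitmx by rewrite B'E unitmx_mul uUQ.
have LB' : row_span B = row_span B'.
  rewrite B'E; apply/seteqP; split=> _ [z _ <-].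
    exists (z *m invmx U) => //; rewrite map_mxM -mulmxA [map_mx _ (invmx U) *m _]mulmxA.
    by rewrite -map_mxM mulVmx // map_mx1 mul1mx.
  by exists (z *m U) => //; rewrite map_mxM mulmxA.
have B'J : kappa%:R *: (B' *m Jmx N *m B'^T) = Jmx N.
  rewrite -[RHS]map_Jint -[X in _ = map_mx _ X]UM !map_mxM -ME B'E trmx_mul map_trmx /MQ.
  by rewrite -scalemxAr -scalemxAl !mulmxA.
have [W WB'] : exists W : 'M[int]_(N + N), invmx B' = map_mx intr W.
  have rW i : exists w : 'rV[int]_(N + N), row i (1%:M : 'M[rat]_(N + N)) = map_mx intr w *m B'.
    have : row_span B' (row i 1%:M).
      by rewrite -LB'; apply: ZL; exists (row i 1%:M) => //; rewrite map_row map_mx1.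
    by move=> [w _ wE]; exists w.
  have [w wE] := choice rW; exists (\matrix_i w i).
  apply: (can_inj (mulmxK uB')); rewrite mulVmx //.
  by apply/row_matrixP => i; rewrite row_mul -map_row rowK -wE.
have gJ : (map_mx intr W^T : 'M[rat]_(N + N))^T *m Jmx N *m map_mx intr W^T = kappa%:R *: Jmx N.
  rewrite -map_trmx trmxK -WB' -{1}B'J -scalemxAr -scalemxAl; congr (_ *: _).
  by rewrite !mulmxA mulVmx // mul1mx -mulmxA -trmx_mul mulVmx // trmx1 mulmx1.
exists W^T; split.
- split; last by exists kappa%:R.
  by rewrite -map_trmx unitmx_tr -WB' unitmx_inv.
- rewrite -km -(absz_nat kappa) -(@similitude_det _ W^T kappa%:Z); first by rewrite abszE.
  apply: (map_intr_inj (R := rat)).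
  by rewrite !map_mxM map_mxZ -map_trmx map_Jint gJ.
- by rewrite LB' -map_trmx -WB' trmx_inv trmxK invmxK.
Qed.

(** The power of gcd(kappa, a) divides ab and is prime to b, so it divides a, and similarly for b.
    Since kappa divides the product of the two gcds, ab divides the product of their powers, which
    forces equality. *)
Lemma gcdn_root_coprime (n kappa a b : nat) : (0 < a)%N -> (0 < b)%N -> coprime a b ->
  (kappa ^ n.+1 = a * b)%N ->
  (gcdn kappa a ^ n.+1)%N = a /\ (gcdn kappa b ^ n.+1)%N = b.
Proof.
move=> a0 b0 ab kE; set al := gcdn kappa a; set be := gcdn kappa b.
have dvdX c d : (0 < d)%N -> coprime c d -> (kappa ^ n.+1 = c * d)%N ->
    (gcdn kappa c ^ n.+1 %| c)%N.
  move=> d0 cd E; have co : coprime (gcdn kappa c ^ n.+1) d.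
    by apply: coprimeXl; apply: coprime_dvdl cd; exact: dvdn_gcdr.
  by rewrite -(Gauss_dvdl _ co) -E dvdn_exp2r // dvdn_gcdl.
have ala : (al ^ n.+1 %| a)%N by exact: dvdX b0 ab kE.
have beb : (be ^ n.+1 %| b)%N.
  by apply: (dvdX b a) => //; [rewrite coprime_sym|rewrite mulnC].
have kab : (kappa %| al * be)%N.
  have kab' : (kappa %| a * b)%N by rewrite -kE expnS dvdn_mulr.
  by rewrite /al /be muln_gcdl !muln_gcdr !dvdn_gcd kab'
    !(dvdn_mulr _ (dvdnn kappa)) (dvdn_mull _ (dvdnn kappa)).
have abX : (a * b %| al ^ n.+1 * be ^ n.+1)%N by rewrite -kE -expnMn dvdn_exp2r.
split; apply/eqP; rewrite eqn_dvd ?ala ?beb /=.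
  by rewrite -(dvdn_pmul2r b0); apply: dvdn_trans abX _; rewrite dvdn_mul.
by rewrite -(dvdn_pmul2l a0); apply: dvdn_trans abX _; rewrite dvdn_mul.
Qed.

(** * The family of symplectic superlattices *)

Section SymplecticFamily.
Variable n : nat.
Local Notation K := (n.+1 + n.+1)%N.
Local Notation Z := (Zlattice K).
Implicit Types L : set 'rV[rat]_K.

Lemma symplectic_superlattices_torsion m L : (0 < m)%N ->
  symplectic_superlattices n.+1 m L ->
  [/\ is_lattice L, (Z `<=` L)%classic & forall x, L x -> Z (x *+ m)].
Proof.
move=> m0 /(symplectic_superlatticesP L m0)[iL ZL [kappa [k0 <- Lk]]].
split=> // x Lx; apply: (superlattice_dvd (superlatticeZ K) (dvdn_exp _ (dvdnn kappa))) => //.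
exact: (symplectic_type_torsion ZL Lk Lx).
Qed.

Lemma symplectic_superlattices_symmetric (z : 'rV[int]_K) :
  exists (g : 'M[int]_K) (c : int),
  [/\ g \in unitmx, z *m g = c *: delta_mx 0 (lshift _ ord0) &
      forall m L, (0 < m)%N -> symplectic_superlattices n.+1 m L <->
        symplectic_superlattices n.+1 m [set x *m map_mx intr g | x in L]%classic].
Proof.
have [g [c [ug zg gJ]]] := symplectic_transitive z; exists g, c; split=> // m L m0.
rewrite !symplectic_superlatticesP //; split=> -[iL ZL [kappa [k0 km Lk]]]; split.
- exact: (is_lattice_act ug L).1.
- exact: (sub_Zlattice_act ug L).1.
- by exists kappa; split=> //; exact: (symplectic_type_act ug gJ kappa L).1.
- exact: (is_lattice_act ug L).2.
- exact: (sub_Zlattice_act ug L).2.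
- by exists kappa; split=> //; exact: (symplectic_type_act ug gJ kappa L).2.
Qed.

(** A multiplier kappa for index ab factors into coprime al and be whose powers are a and b, and
    duality splits accordingly. In the other direction the multipliers of the two parts are
    multiplied. *)
Lemma symplectic_superlattices_coprime a b L : (0 < a)%N -> (0 < b)%N ->
  coprime a b -> superlattice L -> (forall x, L x -> Z (x *+ (a * b))) ->
  symplectic_superlattices n.+1 (a * b) L <->
  symplectic_superlattices n.+1 a (torsion_part L a) /\
  symplectic_superlattices n.+1 b (torsion_part L b).
Proof.
move=> a0 b0 ab sL abL; have ab0 : (0 < a * b)%N by rewrite muln_gt0 a0.
have sT c : superlattice (torsion_part L c) by exact: superlattice_torsion.
have iT c : is_lattice (torsion_part L c).
  by apply: superlattice_is_lattice ab0 _ => // x [/abL].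
have iL : is_lattice L by exact: superlattice_is_lattice ab0 abL.
rewrite !symplectic_superlatticesP //; split.
  move=> [_ ZL [kappa [k0 kE Lk]]].
  have [alE beE] := gcdn_root_coprime a0 b0 ab kE.
  set al := gcdn kappa a in alE; set be := gcdn kappa b in beE.
  have al0 : (0 < al)%N by rewrite gcdn_gt0 k0.
  have be0 : (0 < be)%N by rewrite gcdn_gt0 k0.
  have albe : coprime al be.
    by apply: coprime_dvdl (dvdn_gcdr _ _) _; apply: coprime_dvdr (dvdn_gcdr _ _) ab.
  have kalbe : kappa = (al * be)%N.
    by apply/eqP; rewrite -(@eqn_exp2r _ _ n.+1) // expnMn alE beE kE.
  (* As kappa annihilates L modulo Z^k, an element annihilated by [c] is annihilated by gcd(kappa,
     c). *)
  have part c : torsion_part L c = torsion_part L (gcdn kappa c).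
    apply/seteqP; split=> x [Lx Zx]; split=> //; last first.
      exact: superlattice_dvd (superlatticeZ K) (dvdn_gcdr _ _) Zx.
    have Zk := symplectic_type_torsion ZL Lk Lx.
    have [d d0 dP] := exists_order k0 Zk.
    by apply/dP; rewrite dvdn_gcd; apply/andP; split; apply/dP.
  split; split=> //; try exact: (sT _).1.
    exists al; split=> //; rewrite part; apply: (symplectic_type_part al0 be0 albe sL).
    by rewrite -kalbe.
  exists be; split=> //; rewrite part; apply: (symplectic_type_part be0 al0 _ sL).
    by rewrite coprime_sym.
  by rewrite mulnC -kalbe.
move=> [[_ _ [al [al0 alE La]]] [_ _ [be [be0 beE Lb]]]]; split=> //; first exact: sL.1.
exists (al * be)%N; split; first by rewrite muln_gt0 al0.
  by rewrite expnMn alE beE.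
have albe : coprime al be.
  by move: ab; rewrite -alE -beE coprime_pexpl // coprime_pexpr.
have /coprimezP[[u v] /= uv] : coprimez a%:Z b%:Z by [].
by rewrite -(join_torsion uv sL abL); exact: symplectic_type_join.
Qed.

End SymplecticFamily.

Theorem theoremB (R : realType) (X : lie_type) (n : nat) (n_gt0 : (0 < n)%N)
    (l : nat) (l_le : (l <= ambient_dim X n)%N)
    (P : set 'rV[R]_(ambient_dim X n)) (P_polytope : lattice_polytope P)
    (EP_neq0 : ehrhart_coef P (Zlattice (ambient_dim X n)) l != 0)
    (a b : nat) (a_gt0 : (0 < a)%N) (b_gt0 : (0 < b)%N)
    (ab_coprime : coprime a b) :
  hecke_coef X n P l (a * b)%N = hecke_coef X n P l a * hecke_coef X n P l b.
Proof.
case: n n_gt0 l_le P P_polytope EP_neq0 => // n _ _.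
case: X => /= P P_polytope EP_neq0; rewrite /hecke_coef /=.
  apply: (@hecke_multiplicative n.+1 ord0 (superlattices n.+1)) => //.
  - by move=> m L _; exact: superlattices_torsion.
  - move=> z; have [g [c [ug zg]]] := unimodular_transitive z.
    by exists g, c; split=> // m L _; exact: superlattices_act.
  - by move=> *; exact: superlattices_coprime.
apply: (@hecke_multiplicative (n.+1 + n.+1) (lshift _ ord0)
  (symplectic_superlattices n.+1)) => //.
- exact: symplectic_superlattices_torsion.
- exact: symplectic_superlattices_symmetric.
- exact: symplectic_superlattices_coprime.
Qed.
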